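(* Let $k$ be a field. Let $n\ge2$ and $n=n_0+n_1+\cdots+n_r$ with $r\ge2$ and $n_i\ge1$ for $0\le i\le r$, and let $k[T_0,T_1,\dots,T_r]$ be the polynomial ring in $n$ variables $t_{ij}$, where $T_i=\{t_{i1},\dots,t_{in_i}\}$. Let $\beta_i=(\beta_{i1},\dots,\beta_{in_i})$ be tuples of positive integers ($0\le i\le r$) such that, with $d_i=\gcd(\beta_{i1},\dots,\beta_{in_i})$, the integers $d_0,\dots,d_r$ are pairwise relatively prime, and write $T_i^{\beta_i}=t_{i1}^{\beta_{i1}}\cdots t_{in_i}^{\beta_{in_i}}$. Let $\lambda_2,\dots,\lambda_r\in k^*$ be distinct. Then the ring $$B=k[T_0,\dots,T_r]/\big(T_0^{\beta_0}+\lambda_iT_1^{\beta_1}+T_i^{\beta_i}\big)_{2\le i\le r}$$ is an affine rational UFD of dimension $n-r+1$ over $k$, and the image of $T_0^{\beta_0}+\mu T_1^{\beta_1}$ in $B$ is prime for each $\mu\in k^*\setminus\{\lambda_2,\dots,\lambda_r\}$.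
   Context: A domain $B$ finitely generated over $k$ is rational over $k$ if $\mathrm{frac}(B)$ is purely transcendental over $k$. *)

(* Defs.v *)
From HB Require Import structures.
From mathcomp Require Import all_boot all_order all_algebra.
From mathcomp Require Import fraction.
From mathcomp Require Export mpoly.

Set Implicit Arguments.
Unset Strict Implicit.
Unset Printing Implicit Defensive.

Import Order.TTheory GRing.Theory.
Local Open Scope ring_scope.

(* Quotient rings B = R / I are represented by the pair (R, I), where I is   *)
(* an ideal of the commutative ring R (given as a predicate); an element of  *)
(* B is represented by any of its preimages in R, and "x = y in B" means    *)
(* I (x - y).                                                                *)
Section QuotientRingNotions.
Variables (R : comNzRingType) (I : R -> Prop).

Definition unitQ (u : R) : Prop := exists v : R, I (u * v - 1).

Definition dvdQ (a b : R) : Prop := exists c : R, I (b - a * c).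

Definition assocQ (a b : R) : Prop := exists u : R, unitQ u /\ I (b - u * a).

Definition domainQ : Prop :=
  ~ I 1 /\ forall a b : R, I (a * b) -> I a \/ I b.

Definition irredQ (a : R) : Prop :=
  ~ I a /\ ~ unitQ a /\
  forall b c : R, I (a - b * c) -> unitQ b \/ unitQ c.

Definition primeQ (p : R) : Prop :=
  ~ I p /\ ~ unitQ p /\
  forall a b : R, dvdQ p (a * b) -> dvdQ p a \/ dvdQ p b.

Definition UFDQ : Prop :=
  domainQ /\
  (forall a : R, ~ I a -> ~ unitQ a ->
     exists s : seq R, (forall x, x \in s -> irredQ x) /\
                       assocQ a (\prod_(x <- s) x)) /\
  (forall s t : seq R,
     (forall x, x \in s -> irredQ x) -> (forall x, x \in t -> irredQ x) ->
     assocQ (\prod_(x <- s) x) (\prod_(x <- t) x) ->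
     size s = size t /\
     exists t' : seq R, perm_eq t t' /\
       forall i, (i < size s)%N -> assocQ (nth 0 s i) (nth 0 t' i)).

Definition prime_ideal (P : R -> Prop) : Prop :=
  P 0 /\ (forall a b, P a -> P b -> P (a + b)) /\
  (forall a b, P b -> P (a * b)) /\ ~ P 1 /\
  (forall a b, P (a * b) -> P a \/ P b).

(* a strictly increasing chain P_0 < P_1 < ... < P_d of prime ideals of R/I,
   i.e. of prime ideals of R containing I (correspondence theorem) *)
Definition prime_chainQ (d : nat) (P : nat -> R -> Prop) : Prop :=
  (forall i, (i <= d)%N -> prime_ideal (P i) /\ forall x, I x -> P i x) /\
  (forall i, (i < d)%N ->
     (forall x, P i x -> P i.+1 x) /\ exists x, P i.+1 x /\ ~ P i x).

Definition krull_dimQ (d : nat) : Prop :=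
  (exists P, prime_chainQ d P) /\ ~ (exists P, prime_chainQ d.+1 P).

End QuotientRingNotions.

Definition gen_ideal (R : comNzRingType) (J : finType) (S : pred J)
  (f : J -> R) (x : R) : Prop :=
  exists g : J -> R, x = \sum_(j | S j) g j * f j.

(* For a field k, a k-algebra B = {mpoly k[N]}/I is rational over k:
   its fraction field is k-isomorphic to a purely transcendental extension
   k(Y_1, ..., Y_m) = {fraction {mpoly k[m]}}.  Concretely: there is a
   k-algebra morphism phi from k[X] to k(Y_1..Y_m) whose kernel is exactly I
   (so B embeds into k(Y)), and whose image generates k(Y) as a field, i.e.
   k(Y) is the fraction field of phi(B). *)
Definition rationalQ (k : fieldType) (N : nat) (I : {mpoly k[N]} -> Prop)
  : Prop :=
  exists (m : nat) (phi : {rmorphism {mpoly k[N]} -> {fraction {mpoly k[m]}}}),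
    (forall c : k, phi c%:MP = FracField.tofrac (c%:MP)) /\
    (forall x, phi x = 0 <-> I x) /\
    (forall z : {fraction {mpoly k[m]}}, exists x y, z = phi x / phi y).

(* The data of the theorem.  Blocks of variables T_0, ..., T_r with         *)
(* |T_i| = ns i; the variables of k[T_0,...,T_r] = {mpoly k[n]} with        *)
(* n = \sum_i ns i are indexed through the canonical bijection              *)
(* tagnat.Rank : {i & 'I_(ns i)} -> 'I_n, so t_{ij} = 'X_(Rank i j).        *)

Definition tvar (k : fieldType) (r : nat) (ns : 'I_r.+1 -> nat)
  (i : 'I_r.+1) (j : 'I_(ns i)) : {mpoly k[\sum_(l < r.+1) ns l]} :=
  'X_(tagnat.Rank i j).

Definition Tpow (k : fieldType) (r : nat) (ns : 'I_r.+1 -> nat)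
  (beta : forall i : 'I_r.+1, 'I_(ns i) -> nat) (i : 'I_r.+1)
  : {mpoly k[\sum_(l < r.+1) ns l]} :=
  \prod_(j < ns i) tvar k j ^+ beta i j.

Definition dgcd (r : nat) (ns : 'I_r.+1 -> nat)
  (beta : forall i : 'I_r.+1, 'I_(ns i) -> nat) (i : 'I_r.+1) : nat :=
  \big[gcdn/0%N]_(j < ns i) beta i j.

(* Main.v *)
Require Import Defs.
From HB Require Import structures.
From mathcomp Require Import all_boot all_order all_algebra.
From mathcomp Require Import fraction mpoly.
From mathcomp Require Import zify ring.
From Stdlib Require Import Classical FunctionalExtensionality.

(** Inverting the variables turns [B] into a localization of a polynomial ring:
    with [z = T_0 / T_1] one has [T_l = g_l(z) T_1] for polynomials
    [g_0 = z], [g_1 = 1], [g_l = - (z + lambda_l)], and since the [d_l] are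
    pairwise coprime the exponent lattice of the relations is a direct summand.
    Hence each variable is a product of powers of the [g_l(z)] and of new
    independent variables [Y_j], which embeds [B] into [k(z, Y)] and gives
    rationality.  That nothing but the ideal is killed is seen on normal
    forms: monomials modulo the [T_l] go to distinct [Y]-monomials.  The same
    computation with [z] specialized to a root of [g_l], or to [- mu], shows
    that the variables and [T_0 + mu T_1] are prime, and Nagata's criterion
    lifts unique factorization from [k[z, Y]] to [B].  The dimension is
    bounded above by the transcendence degree (counting monomials), and below
    by an explicit chain of primes. *)

Set Implicit Arguments.
Unset Strict Implicit.
Unset Printing Implicit Defensive.

Import GRing.Theory.
Local Open Scope ring_scope.

(** * Unique factorization in polynomial rings *)

(** One kernel theorem, [blocks_kernel], serves both the embedding and the primes. It concerns any
    ideal [J] modulo which each [T_l] is a linear form in two elements with the coefficients of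
    [G l]. With [G l = g_l] it computes the defining ideal [I], with constant [G l] it computes
    [I + (p)]. Hence [B] is not assumed to be a domain: this follows once [I] is known to be the
    whole kernel. The direct summand is found as follows. Bezout coefficients on each block give an
    integer functional with value [d_l] on the exponents of [T_l]. Coprimality allows rescaling
    these so that block [i] gets the value [t + [i = l]]. The uncontrolled shift [t] drops out
    because the relevant rows are differences, the exponents of [T_l / T_1]. Killing a variable
    makes its whole block monomial vanish, which would lose the other variables of that block.
    Exponents are therefore changed there to those of the variable alone, whose gcd 1 keeps all gcds
    coprime. Nagata's criterion also needs a bound on how many variables can be divided out of an
    element. It comes from a positive grading for which the relations are homogeneous. *)

Section Factorial.
Variable R : idomainType.
Implicit Types a b c p : R.

Definition rdvd a b := exists c, b = a * c.

Definition rprime p :=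
  [/\ p != 0, p \isn't a GRing.unit &
      forall a b, rdvd p (a * b) -> rdvd p a \/ rdvd p b].

Definition prime_factored a := exists u (s : seq R),
  [/\ u \is a GRing.unit, forall p, p \in s -> rprime p
    & a = u * \prod_(p <- s) p].

(** Asking for prime rather than irreducible factors makes uniqueness automatic, so existence alone
    expresses factoriality. *)
Definition is_factorial := forall a, a != 0 -> prime_factored a.

Lemma rdvdD a b c : rdvd a b -> rdvd a c -> rdvd a (b + c).
Proof. by move=> [x ->] [y ->]; exists (x + y); rewrite mulrDr. Qed.

Lemma rdvdB a b c : rdvd a b -> rdvd a c -> rdvd a (b - c).
Proof. by move=> [x ->] [y ->]; exists (x - y); rewrite mulrBr. Qed.

Lemma rdvdMr a b c : rdvd a b -> rdvd a (b * c).
Proof. by move=> [x ->]; exists (x * c); rewrite mulrA. Qed.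

Lemma rdvdMl a b c : rdvd a b -> rdvd a (c * b).
Proof. by rewrite mulrC; apply: rdvdMr. Qed.

Lemma prime_factoredM a b :
  prime_factored a -> prime_factored b -> prime_factored (a * b).
Proof.
move=> [u [s [uu sp ->]]] [v [t [vu tp ->]]]; exists (u * v), (s ++ t).
split; first by rewrite unitrM uu.
  by move=> p; rewrite mem_cat => /orP[/sp|/tp].
by rewrite big_cat mulrACA.
Qed.

End Factorial.

Section PolyFactorial.
Variable R : idomainType.
Implicit Types (f g h : {poly R}) (c p : R).

Lemma rdvd_polyCP p f : rdvd p%:P f <-> forall i, rdvd p f`_i.
Proof.
split=> [[g ->] i|]; first by exists g`_i; rewrite coefCM.
elim/poly_ind: f => [_|f c IH dvd]; first by exists 0; rewrite mulr0.
have [|g ->] := IH.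
  by move=> i; have := dvd i.+1; rewrite coefD coefMX coefC addr0.
have [d] := dvd 0; rewrite coefD coefMX coefC add0r /= => ->.
by exists (g * 'X + d%:P); rewrite mulrDr mulrA polyCM.
Qed.

(** Gauss's lemma by induction on both factors: [p] divides the product of the constant terms, hence
    one of them. That term is removed from its factor, the remaining ['X] is cancelled, and
    induction treats the shorter factor. *)
Lemma rprime_polyC p : rprime p -> rprime p%:P.
Proof.
move=> [p0 pu pp]; split; first by rewrite polyC_eq0.
  by apply/negP; rewrite poly_unitE coefC /= (negPf pu) andbF.
have dX f g : rdvd p%:P (f * 'X * g) -> rdvd p%:P (f * g).
  move/rdvd_polyCP=> d; apply/rdvd_polyCP=> i.
  by have := d i.+1; rewrite mulrAC coefMX.
elim/poly_ind=> [|f c IHf]; first by left; exists 0; rewrite mulr0.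
elim/poly_ind=> [|g d IHg]; first by right; exists 0; rewrite mulr0.
move=> dv; have /rdvd_polyCP/(_ 0%N) := dv.
rewrite coefM big_ord1 !coefD !coefMX !coefC !add0r /= => /pp[] [e ce].
- have dc : rdvd p%:P c%:P by exists e%:P; rewrite ce polyCM.
  have := rdvdB dv (rdvdMr (g * 'X + d%:P) dc).
  rewrite mulrDl addrK => /dX/IHf[dvf|]; last by right.
  by left; apply: rdvdD => //; apply: rdvdMr.
have dd : rdvd p%:P d%:P by exists e%:P; rewrite ce polyCM.
have := rdvdB dv (rdvdMl (f * 'X + c%:P) dd).
rewrite mulrDr addrK mulrC => /dX.
rewrite [_ * (_ + _)]mulrC => /IHg[|dvg]; first by left.
by right; apply: rdvdD => //; apply: rdvdMr.
Qed.

Hypothesis facR : is_factorial R.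

(** The primes of [c] stay prime in [{poly R}], so each can be divided out of [f] or of [g]. The
    sizes are recorded because they decide later which factor is constant. *)
Lemma cancel_content c f g h : c != 0 -> c%:P * h = f * g ->
  exists f' g', [/\ h = f' * g', size f' = size f & size g' = size g].
Proof.
move=> /facR[u [s [uu sp ->]]]; elim: s sp f g => [|p s IH] sp f g.
  rewrite big_nil mulr1 => eh; exists ((u^-1)%:P * f), g; split=> //.
    by rewrite -mulrA -eh mulrA -polyCM mulVr // mul1r.
  by rewrite size_Cmul // invr_eq0; apply: contraTneq uu => ->; rewrite unitr0.
have [p0 _ _] := sp p (mem_head _ _).
have [_ _ pp] := rprime_polyC (sp p (mem_head _ _)).
have spt q : q \in s -> rprime q by move=> qs; apply: sp; rewrite inE qs orbT.
have pC0 : p%:P != 0 by rewrite polyC_eq0.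
rewrite big_cons mulrCA polyCM -mulrA => eh.
have [] := pp f g; first by exists ((u * \prod_(j <- s) j)%:P * h).
  move=> [f' ef]; have {}eh : (u * \prod_(j <- s) j)%:P * h = f' * g.
    by apply: (mulfI pC0); rewrite eh ef mulrA.
  have [f2 [g2 [-> sf sg]]] := IH spt _ _ eh; exists f2, g2; split=> //.
  by rewrite sf ef size_Cmul.
move=> [g' eg]; have {}eh : (u * \prod_(j <- s) j)%:P * h = f * g'.
  by apply: (mulfI pC0); rewrite eh eg mulrCA.
have [f2 [g2 [-> sf sg]]] := IH spt _ _ eh; exists f2, g2; split=> //.
by rewrite sg eg size_Cmul.
Qed.

(** The primes of [c] are removed as before, but a primitive [f] forces each of them into [g], so
    [f] survives unchanged as a divisor. *)
Lemma primitive_cancel_content c f g h :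
  (forall p, rprime p -> ~ rdvd p%:P f) -> c != 0 -> c%:P * h = f * g ->
  rdvd f h.
Proof.
move=> prim /facR[u [s [uu sp ->]]]; elim: s sp g => [|p s IH] sp g.
  rewrite big_nil mulr1 => eh; exists ((u^-1)%:P * g).
  by rewrite mulrCA -eh mulrA -polyCM mulVr // mul1r.
have [p0 _ _] := sp p (mem_head _ _).
have [_ _ pp] := rprime_polyC (sp p (mem_head _ _)).
have spt q : q \in s -> rprime q by move=> qs; apply: sp; rewrite inE qs orbT.
rewrite big_cons mulrCA polyCM -mulrA => eh.
have [|/prim|] := pp f g; first by exists ((u * \prod_(j <- s) j)%:P * h).
  by move=> /(_ (sp p (mem_head _ _))).
move=> [g' eg]; apply: (IH spt g').
have pC0 : p%:P != 0 by rewrite polyC_eq0.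
by apply: (mulfI pC0); rewrite eh eg mulrCA.
Qed.

(** Here [%|] is divisibility up to a nonzero scalar, that is, over the fraction field, where gcds
    exist. If [gcdp f a] is constant then [f %| b], and primitivity removes the scalar. Otherwise
    the gcd yields a true factor of [f] of the same size, and irreducibility makes its cofactor
    constant. *)
Lemma primitive_irred_prime f : (1 < size f)%N ->
  (forall p, rprime p -> ~ rdvd p%:P f) ->
  (forall g h, f = g * h -> (1 < size g)%N -> (1 < size h)%N -> False) ->
  rprime f.
Proof.
move=> sf prim irr; have f0 : f != 0 by rewrite -size_poly_gt0 ltnW.
have dvd_f g : (f %| g)%R -> rdvd f g.
  move=> /Pdiv.WeakIdomain.dvdpP[[c q] /= c0 cg].
  by apply: (primitive_cancel_content prim c0 (g := q)); rewrite mul_polyC cg mulrC.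
split=> //; first by rewrite poly_unitE gtn_eqF.
move=> a b [c abc].
have fab : f %| a * b by rewrite abc Pdiv.Idomain.dvdp_mulIl.
have [g1|g1] := eqVneq (size (gcdp f a)) 1%N.
  right; apply: dvd_f; rewrite -(Pdiv.Idomain.Gauss_dvdpr b (q := a)) //.
  by rewrite Pdiv.Idomain.coprimep_def g1.
left; apply: dvd_f; have := Pdiv.Idomain.dvdp_gcdr f a.
have df := Pdiv.Idomain.dvdp_gcdl f a.
have d0 : gcdp f a != 0.
  by apply: contraNneq f0 => d0; move: df; rewrite d0 Pdiv.Idomain.dvd0p.
suff /Pdiv.Idomain.eqp_dvdl -> : gcdp f a %= f by [].
rewrite -Pdiv.Idomain.dvdp_size_eqp //.
have /Pdiv.WeakIdomain.dvdpP[[e q] /= e0] := df.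
rewrite -mul_polyC => /(cancel_content e0)[q' [d' [ef sq sd]]].
have sd1 : (1 < size d')%N by rewrite sd ltn_neqAle eq_sym g1 size_poly_gt0.
have q0 : q' != 0 by apply: contraNneq f0 => q0; rewrite ef q0 mul0r.
have sq1 : size q' = 1%N.
  apply/eqP; rewrite eqn_leq size_poly_gt0 q0 andbT leqNgt.
  by apply/negP=> /(irr _ _ ef)/(_ sd1).
by rewrite -sd ef size_mul ?sq1 // -size_poly_gt0 ltnW.
Qed.

Lemma rprime_dvd_prod p (s : seq R) : rprime p -> rdvd p (\prod_(q <- s) q) ->
  exists2 q, q \in s & rdvd p q.
Proof.
move=> [p0 pu pP]; elim: s => [|q s IH].
  by rewrite big_nil => -[c /esym pc]; case/negP: pu; apply/unitrPr; exists c.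
rewrite big_cons => /pP[pq|/IH[q' q's pq']]; first by exists q; rewrite ?mem_head.
by exists q'; rewrite // inE q's orbT.
Qed.

(** A prime dividing [f] divides its leading coefficient, hence is associate to one of the finitely
    many prime factors of that coefficient. Each division by such a prime shortens that list. *)
Lemma content_primitive f : f != 0 -> exists c g,
  [/\ c != 0, f = c%:P * g & forall p, rprime p -> ~ rdvd p%:P g].
Proof.
move=> f0; have := f0; rewrite -lead_coef_eq0 => /facR[u [s [uu]]].
elim: {s}(size s) {-2}s (erefl (size s)) f f0 => [|n IH] s ss f f0 sp lf.
  exists 1, f; split; rewrite ?oner_neq0 ?mul1r // => p [_ pu _] /rdvd_polyCP.
  move/(_ (size f).-1); rewrite [f`_ _]lf (size0nil ss) big_nil mulr1 => -[c uc].
  by case/negP: pu; move: uu; rewrite uc unitrM => /andP[].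
have [[q qs [g ef]]|nq] := classic (exists2 q, q \in s & rdvd q%:P f).
  have [q0 _ _] := sp q qs.
  have g0 : g != 0 by apply: contraNneq f0 => g0; rewrite ef g0 mulr0.
  have [|||c [h [c0 eg ph]]] := IH (rem q s) _ g g0.
  - by rewrite size_rem // ss.
  - by move=> p /mem_rem; apply: sp.
  - apply: (mulfI q0); rewrite -(lead_coefC q) -lead_coefM -ef lf.
    by rewrite (big_rem q) //= lead_coefC mulrCA.
  by exists (q * c), h; split; rewrite ?mulf_neq0 // ef eg polyCM mulrA.
exists 1, f; split; rewrite ?oner_neq0 ?mul1r // => p pp pf.
have [p0 pu pP] := pp.
have /rdvd_polyCP/(_ (size f).-1) := pf; rewrite [f`_ _]lf => -[c].
move/(congr1 ( *%R u^-1)); rewrite mulKr // mulrCA => e.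
have [|q qs [v qv]] := @rprime_dvd_prod p s pp; first by exists (u^-1 * c).
have [q0 qu qP] := sp q qs.
have [|[w pw]|[w vw]] := qP p v; first by exists 1; rewrite mulr1 -qv.
  by apply: nq; exists q => //; case: pf => g ->; exists (w%:P * g);
    rewrite pw polyCM mulrA.
case/negP: pu; apply/unitrPr; exists w; apply: (mulfI q0).
by rewrite mulr1 {2}qv vw mulrCA.
Qed.

Theorem poly_factorial : is_factorial {poly R}.
Proof.
move=> f; have [n] := ubnP (size f); elim: n f => // n IH f sf f0.
have [[g [h [efg sg sh]]]|irr] := classic (exists g h,
    [/\ f = g * h, (1 < size g)%N & (1 < size h)%N]).
  have g0 : g != 0 by rewrite -size_poly_gt0 ltnW.
  have h0 : h != 0 by rewrite -size_poly_gt0 ltnW.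
  have sE := size_mul g0 h0; rewrite -efg in sE.
  rewrite efg; apply: prime_factoredM; apply: IH => //; move: sf sE sg sh; lia.
have [c [g [c0 ef pg]]] := content_primitive f0.
rewrite ef; apply: prime_factoredM.
  have [u [s [uu sp ->]]] := facR c0; exists u%:P, (map polyC s); split.
  - have u0 : u != 0 by apply: contraTneq uu => ->; rewrite unitr0.
    by rewrite poly_unitE size_polyC coefC /= uu u0.
  - by move=> p /mapP[q /sp qp ->]; apply: rprime_polyC.
  by rewrite big_map polyCM rmorph_prod.
(* A primitive constant has no prime factor, hence is a unit. A nonconstant [g] is irreducible
   because splitting it into nonconstant factors would split [f]. *)
have [sg|sg] := leqP (size g) 1.
  have g0 : g`_0 != 0.
    apply: contraNneq f0 => g0; rewrite ef (size1_polyC sg) g0 polyC0 mulr0 //.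
  have gu : g`_0 \is a GRing.unit.
    have [u [[|p s] [uu sp eg]]] := facR g0; first by rewrite eg big_nil mulr1.
    case: (pg p (sp _ (mem_head _ _))); rewrite (size1_polyC sg) eg big_cons.
    by exists (u * \prod_(j <- s) j)%:P; rewrite -polyCM mulrCA.
  exists g, [::]; split=> //; last by rewrite big_nil mulr1.
  by rewrite poly_unitE gu andbT eqn_leq sg size_poly_gt0; apply: contraNneq g0 => ->; rewrite coef0.
exists 1, [:: g]; split; rewrite ?unitr1 // ?big_seq1 ?mul1r // => p.
rewrite inE => /eqP->; apply: primitive_irred_prime => // g1 h1 eg s1 s2.
apply: irr; exists (c%:P * g1), h1; split=> //; first by rewrite ef eg mulrA.
by rewrite size_Cmul.
Qed.

End PolyFactorial.

Lemma mpoly_rmorph_eq (n : nat) (R : comNzRingType) (S : nzRingType)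
  (f g : {rmorphism {mpoly R[n]} -> S}) :
  (forall c, f c%:MP = g c%:MP) -> (forall i, f 'X_i = g 'X_i) -> f =1 g.
Proof.
move=> eC eX p; rewrite [p]mpolyE !rmorph_sum; apply: eq_bigr => m _.
rewrite -mul_mpolyC !rmorphM eC mpolyXE_id !rmorph_prod; congr (_ * _).
by apply: eq_bigr => i _; rewrite !rmorphXn eX.
Qed.

Lemma factorial_iso (R S : idomainType) (f : {rmorphism R -> S})
  (g : {rmorphism S -> R}) : cancel f g -> cancel g f -> is_factorial S ->
  is_factorial R.
Proof.
move=> fK gK facS a a0.
have [|u [s [uu sp fa]]] := facS (f a); first by rewrite -(rmorph0 f) (can_eq fK).
exists (g u), (map g s); split; first exact: rmorph_unit.
  move=> _ /mapP[p /sp[p0 pu pP] ->]; split.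
  - by rewrite -(rmorph0 g) (can_eq gK).
  - by apply: contra pu => /(rmorph_unit f); rewrite gK.
  move=> b c [d bcd]; have [|[e fb]|[e fc]] := pP (f b) (f c).
  - by exists (f d); rewrite -rmorphM bcd rmorphM gK.
  - by left; exists (g e); rewrite -rmorphM -fb fK.
  by right; exists (g e); rewrite -rmorphM -fc fK.
by rewrite big_map -rmorph_prod -rmorphM -fa fK.
Qed.

Theorem mpoly_factorial (k : fieldType) (n : nat) : is_factorial {mpoly k[n]}.
Proof.
elim: n => [|n IH].
  move=> a a0; exists a, [::]; split; rewrite ?big_nil ?mulr1 //.
  have ea := nvar0_mpolyC a; apply/unitrPr; exists (a@_0%MM)^-1%:MP.
  rewrite {1}ea -mpolyCM divff ?mpolyC1 //.
  by apply: contraNneq a0 => e; rewrite ea e mpolyC0.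
(* The inverse of [muni], which views a polynomial as univariate in the last variable. *)
pose g := horner_eval ('X_ord_max : {mpoly k[n.+1]}) \o map_poly (@mwiden n k).
have X_max : @muni n k 'X_ord_max = 'X.
  rewrite muniE msuppX big_seq1 mcoeffX eqxx mnm1E eqxx expr1 scale1r.
  rewrite (_ : [multinom _ | _ < _] = 0%MM) ?mpolyX0 ?scale1r //.
  by apply/mnmP=> i; rewrite mnmE mnm1E mnm0E -val_eqE /= gtn_eqF.
have X_wid i : @muni n k 'X_(widen_ord (leqnSn n) i) = ('X_i)%:P.
  rewrite muniE msuppX big_seq1 mcoeffX eqxx mnm1E -val_eqE /= ltn_eqF // expr0 scale1r.
  rewrite (_ : [multinom _ | _ < _] = U_(i)%MM) ?alg_polyC //.
  by apply/mnmP=> j; rewrite mnmE !mnm1E -val_eqE.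
have wX i : mwiden ('X_i : {mpoly k[n]}) = 'X_(widen_ord (leqnSn n) i).
  by rewrite mwidenX mnmwiden1.
apply: (@factorial_iso _ _ (@muni n k) g) _ _ (poly_factorial IH).
  apply: (@mpoly_rmorph_eq _ _ _ (g \o @muni n k) idfun) => [c|i] /=.
    by rewrite muniC /g /= map_polyC /= /horner_eval hornerC mwidenC.
  have [i' ->|->] := unliftP ord_max i; last first.
    by rewrite X_max /g /= map_polyX /horner_eval hornerX.
  rewrite (_ : lift ord_max i' = widen_ord (leqnSn n) i'); last first.
    by apply/val_inj; rewrite /= /bump leqNgt ltn_ord.
  by rewrite X_wid /g /= map_polyC /horner_eval hornerC /= wX.
have gm : forall c : {mpoly k[n]}, muni (mwiden c) = c%:P.
  apply: (@mpoly_rmorph_eq _ _ _ (@muni n k \o @mwiden n k) polyC) => [c|i] /=.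
    by rewrite mwidenC muniC.
  by rewrite wX X_wid.
elim/poly_ind => [|p c IHp]; first by rewrite !rmorph0.
rewrite 2!rmorphD 2!rmorphM IHp; congr (_ * _ + _).
  by rewrite /g /= map_polyX /horner_eval hornerX X_max.
by rewrite /g /= map_polyC /horner_eval hornerC gm.
Qed.

(** * Monomials in integer powers over k(z) *)

(** A right inverse of [M] makes the square block of its Smith form invertible over the integers. In
    the coordinates given by [Rm] the row lattice of [M] is then the span of the first [p] basis
    vectors; [E] reads the other [q] coordinates and [E'] embeds them back. *)
Lemma int_split_complement (p n : nat) (M : 'M[int]_(p, n)) (N : 'M[int]_(n, p)) :
  M *m N = 1%:M -> exists q (E : 'M[int]_(n, q)) (E' : 'M[int]_(q, n)),
  [/\ n = (p + q)%N, M *m E = 0, E' *m E = 1%:M &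
      forall a : 'rV[int]_n, a *m E = 0 -> exists c, a = c *m M].
Proof.
move=> MN; have [Lm Lu [Rm Ru [d _ defM]]] := int_Smith_normal_form M.
set D := \matrix_(i, j) _ in defM.
have DX : D *m (Rm *m N *m Lm) = 1%:M.
  by rewrite mulmxA; apply: mulmx1C; rewrite !mulmxA -defM.
have le_pn : (p <= n)%N.
  rewrite leqNgt; apply/negP=> lt_np; pose i := Ordinal lt_np.
  have /matrixP/(_ i i) := DX; rewrite !mxE eqxx big1 // => j _.
  by rewrite !mxE /= gtn_eqF // mulr0n mul0r.
have [q def_n] : exists q, n = (p + q)%N by exists (n - p)%N; rewrite subnKC.
have D0 (i : 'I_p) (j : 'I_n) : (p <= j)%N -> D i j = 0.
  by move=> pj; rewrite mxE ltn_eqF ?mulr0n // (leq_trans _ pj).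
move: M N MN Rm Ru D defM DX D0; rewrite {n le_pn}def_n => M N MN Rm Ru D defM DX D0.
have D2 : rsubmx D = 0.
  by apply/matrixP=> i j; rewrite mxE D0 ?mxE //= leq_addr.
have D12 : D = row_mx (lsubmx D) 0 by rewrite -D2 hsubmxK.
pose X1 := usubmx (Rm *m N *m Lm).
have X1D : X1 *m lsubmx D = 1%:M.
  by apply: mulmx1C; rewrite -DX -[Rm *m N *m Lm]vsubmxK D12 mul_row_col row_mxKl mul0mx addr0.
exists q, (invmx Rm *m col_mx 0 1%:M), (row_mx 0 1%:M *m Rm); split=> //.
- by rewrite defM -!mulmxA mulKVmx // D12 mul_row_col mulmx0 mul0mx addr0 mulmx0.
- by rewrite mulmxA mulmxK // mul_row_col mulmx0 mulmx1 add0r.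
move=> a aE; pose b := a *m invmx Rm.
have b2 : rsubmx b = 0.
  by rewrite -aE mulmxA -/b -{2}[b]hsubmxK mul_row_col mulmx0 mulmx1 add0r.
have ab : a = b *m Rm by rewrite /b mulmxKV.
exists (lsubmx b *m X1 *m invmx Lm).
rewrite defM -!mulmxA mulKmx // (mulmxA X1) D12 mul_mx_row mulmx0 X1D.
by rewrite mulmxA mul_mx_row mulmx0 mulmx1 ab -{1}[b]hsubmxK b2.
Qed.

Section Toric.
Variables (k : fieldType) (q : nat).
Local Notation L := {fraction {mpoly k[q.+1]}}.
Local Notation tofrac := (@FracField.tofrac {mpoly k[q.+1]}).

Definition zvar : L := tofrac 'X_ord0.
Definition yvar (j : 'I_q) : L := tofrac 'X_(lift ord0 j).
Definition zeval (p : {poly k}) : L :=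
  tofrac (map_poly (@mpolyC q.+1 k) p).['X_ord0].

Fact zeval_is_zmod_morphism : zmod_morphism zeval.
Proof. by move=> u v; rewrite /zeval rmorphB hornerD hornerN rmorphB. Qed.

Fact zeval_is_monoid_morphism : monoid_morphism zeval.
Proof.
split=> [|u v]; first by rewrite /zeval !rmorph1 hornerC rmorph1.
by rewrite /zeval rmorphM hornerM rmorphM.
Qed.

HB.instance Definition _ :=
  GRing.isZmodMorphism.Build {poly k} L zeval zeval_is_zmod_morphism.
HB.instance Definition _ :=
  GRing.isMonoidMorphism.Build {poly k} L zeval zeval_is_monoid_morphism.

Lemma zevalC c : zeval c%:P = tofrac c%:MP.
Proof. by rewrite /zeval map_polyC hornerC. Qed.

Lemma zevalX : zeval 'X = zvar.
Proof. by rewrite /zeval map_polyX hornerX. Qed.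

Lemma yvar_neq0 j : yvar j != 0.
Proof. by rewrite tofrac_eq0 -msize_poly_eq0 msizeX. Qed.

Definition mnm_cons (i : nat) (m : 'X_{1..q}) : 'X_{1..q.+1} :=
  [multinom (if unlift ord0 v is Some j then m j else i) | v < q.+1].

Lemma mnm_cons_inj i m i' m' :
  (mnm_cons i m == mnm_cons i' m') = (i == i') && (m == m').
Proof.
apply/eqP/andP=> [|[/eqP-> /eqP->] //] /mnmP e; split.
  by have := e ord0; rewrite !mnmE unlift_none => ->.
by apply/eqP/mnmP=> j; have := e (lift ord0 j); rewrite !mnmE liftK.
Qed.

Lemma zeval_yvar p (m : 'X_{1..q}) : zeval p * \prod_j yvar j ^+ m j =
  tofrac (\sum_(i < size p) p`_i *: 'X_[mnm_cons i m]).
Proof.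
rewrite -{1}[p]coefK poly_def !rmorph_sum /= mulr_suml; apply: eq_bigr => i _.
rewrite -mul_polyC rmorphM rmorphXn /= zevalC zevalX -mul_mpolyC rmorphM -mulrA.
congr (_ * _); rewrite mpolyXE_id big_ord_recl rmorphM rmorph_prod /= /zvar -rmorphXn /=.
congr (tofrac ('X__ ^+ _) * _); first by rewrite mnmE unlift_none.
by apply: eq_bigr => j _; rewrite rmorphXn /= mnmE liftK.
Qed.

Lemma zeval_yvar_indep (T : eqType) (s : seq T) (P : T -> {poly k})
  (m : T -> 'X_{1..q}) : uniq s -> {in s &, injective m} ->
  \sum_(a <- s) zeval (P a) * \prod_j yvar j ^+ m a j = 0 ->
  {in s, forall a, P a = 0}.
Proof.
move=> us mi; under eq_bigr => a _ do rewrite zeval_yvar.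
rewrite -rmorph_sum => /eqP; rewrite tofrac_eq0 => /eqP/mpolyP s0 a a_s.
apply/polyP=> i; rewrite coef0.
have := s0 (mnm_cons i (m a)); rewrite mcoeff0 raddf_sum /=.
rewrite (bigD1_seq a) //= [X in _ + X]big1_seq ?addr0; last first.
  move=> b /andP[ba bs]; rewrite raddf_sum big1 // => j _ /=.
  rewrite mcoeffZ mcoeffX mnm_cons_inj; case: eqP => [_|]; last by rewrite mulr0.
  by case: eqP => [/mi|]; rewrite ?mulr0 // => e; rewrite e ?eqxx in ba.
rewrite raddf_sum /= => s1; apply: etrans s1.
have [lt_i|le_i] := ltnP i (size (P a)); last first.
  rewrite nth_default // big1 // => j _; rewrite mcoeffZ mcoeffX mnm_cons_inj.
  by rewrite ltn_eqF ?mulr0 //= (leq_trans (ltn_ord j)).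
rewrite (bigD1 (Ordinal lt_i)) //= mcoeffZ mcoeffX eqxx mulr1 big1 ?addr0 //.
by move=> j ji; rewrite mcoeffZ mcoeffX mnm_cons_inj [_ == i](negPf ji) mulr0.
Qed.

Lemma zeval_eq0 p : (zeval p == 0) = (p == 0).
Proof.
apply/eqP/eqP=> [p0|->]; last by rewrite rmorph0.
apply: (@zeval_yvar_indep _ [:: tt] (fun=> p) (fun=> 0%MM)) (mem_head _ _) => //.
  by case=> [] [].
by rewrite big_seq1 p0 mul0r.
Qed.

Definition zfrac (x : L) := exists u d, d != 0 /\ x = zeval u / zeval d.

Lemma zfrac1 : zfrac 1.
Proof. by exists 1, 1; rewrite rmorph1 divr1 oner_neq0. Qed.

Lemma zfrac_zeval p : zfrac (zeval p).
Proof. by exists p, 1; rewrite rmorph1 divr1 oner_neq0. Qed.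

Lemma zfracM x y : zfrac x -> zfrac y -> zfrac (x * y).
Proof.
move=> [u [d [d0 ->]]] [v [e [e0 ->]]]; exists (u * v), (d * e).
by rewrite mulf_neq0 // !rmorphM invfM mulrACA.
Qed.

Lemma zfracV x : zfrac x -> zfrac x^-1.
Proof.
move=> [u [d [d0 ->]]]; have [->|u0] := eqVneq u 0.
  by exists 0, 1; rewrite oner_neq0 rmorph0 !mul0r invr0.
by exists d, u; rewrite invf_div.
Qed.

Lemma zfracX x n : zfrac x -> zfrac (x ^+ n).
Proof. by move=> fx; elim: n => [|n IH]; [apply: zfrac1|rewrite exprS; apply: zfracM]. Qed.

Lemma zfrac_exprz x (n : int) : zfrac x -> zfrac (x ^ n).
Proof.
by move=> fx; case: n => n; [|apply: zfracV]; apply: zfracX.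
Qed.

Lemma zfrac_prod (I : finType) (F : I -> L) :
  (forall i, zfrac (F i)) -> zfrac (\prod_i F i).
Proof. by move=> h; elim/big_ind: _ => //; [apply: zfrac1|apply: zfracM]. Qed.

Lemma zfrac_common_den (T : eqType) (s : seq T) (c : T -> L) :
  (forall a, zfrac (c a)) -> exists (P : T -> {poly k}) (D : {poly k}),
  D != 0 /\ {in s, forall a, zeval (P a) = zeval D * c a}.
Proof.
move=> cz; elim: s => [|a s [P [D [D0 PD]]]]; first by exists (fun=> 0), 1; rewrite oner_neq0.
have [u [d [d0 ca]]] := cz a; exists (fun b => if b == a then D * u else d * P b), (D * d).
rewrite mulf_neq0 //; split=> // b; rewrite inE.
have [-> _|_ /= /PD e] := eqVneq b a; last by rewrite !rmorphM /= e mulrCA mulrA.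
by rewrite ca !rmorphM /= -mulrA; congr (_ * _); rewrite mulrCA divff ?mulr1 // zeval_eq0.
Qed.

(** A common denominator in [k[z]] and a large power [K] of every [yvar] turn the sum into a
    combination of genuine monomials with coefficients in [k[z]]. *)
Lemma zfrac_yvar_indep (T : eqType) (s : seq T) (c : T -> L)
  (e : T -> 'rV[int]_q) : uniq s -> {in s &, injective e} ->
  (forall a, zfrac (c a)) ->
  \sum_(a <- s) c a * \prod_j yvar j ^ (e a 0 j) = 0 ->
  {in s, forall a, c a = 0}.
Proof.
move=> us ei cz s0; have [P [D [D0 PD]]] := zfrac_common_den s cz.
have [K leK] : exists K : nat, {in s, forall a j, (0 <= e a 0 j + K%:Z)}.
  elim: (s) => [|a s' [K leK]]; first by exists 0%N.
  exists (K + \sum_j absz (e a 0%R j))%N => b; rewrite inE => /orP[/eqP->|/leK h] j.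
    have : (absz (e a 0%R j) <= \sum_j absz (e a 0%R j))%N by rewrite (bigD1 j) //= leq_addr.
    lia.
  have := h j; lia.
pose m a := [multinom absz (e a 0%R j + K%:Z)%R | j < q].
suff P0 : {in s, forall a, P a = 0}.
  move=> a a_s; apply/eqP; have /eqP := PD a a_s.
  by rewrite P0 // rmorph0 eq_sym mulf_eq0 zeval_eq0 (negPf D0).
apply: (zeval_yvar_indep (m := m) us).
  move=> a b a_s b_s /mnmP mab; apply: ei => //; apply/rowP=> j.
  have := mab j; rewrite !mnmE; have := leK a a_s j; have := leK b b_s j; lia.
transitivity (zeval D * \prod_j yvar j ^+ K *
    \sum_(a <- s) c a * \prod_j yvar j ^ (e a 0 j)); last by rewrite s0 mulr0.
rewrite mulr_sumr big_seq [RHS]big_seq; apply: eq_bigr => a a_s.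
rewrite PD // [RHS]mulrACA -big_split; congr (_ * _); apply: eq_bigr => j _ /=.
rewrite mnmE !exprnP -expfzDr ?yvar_neq0 //; congr (_ ^ _).
by have := leK a a_s j; lia.
Qed.

Variables (p n : nat) (M : 'M[int]_(p, n)) (N : 'M[int]_(n, p)).
Variables (E : 'M[int]_(n, q)) (E' : 'M[int]_(q, n)) (G : 'I_p -> {poly k}).
Hypotheses (MN : M *m N = 1%:M) (ME : M *m E = 0) (EE : E' *m E = 1%:M).
Hypothesis kerE : forall a : 'rV[int]_n, a *m E = 0 -> exists c, a = c *m M.
Hypothesis G0 : forall l, G l != 0.

(** A point at which the Laurent monomial with exponents row [l] of [M] takes the value [G l]: [MN]
    puts exponent 1 on [G l] alone, and [ME] cancels the [yvar]s, which parametrize the remaining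
    freedom. *)
Definition toric (v : 'I_n) : L :=
  (\prod_l zeval (G l) ^ N v l) * \prod_j yvar j ^ E v j.

Lemma expfz_prod (I : finType) (F : I -> L) (m : int) :
  (\prod_i F i) ^ m = \prod_i F i ^ m.
Proof. by elim/big_rec2: _ => [|i x y _ <-]; rewrite ?exp1rz ?expfzMl. Qed.

Lemma prod_exprz_mulmx (I J : nat) (x : 'I_J -> L) (a : 'rV[int]_I)
  (A : 'M[int]_(I, J)) : (forall j, x j != 0) ->
  \prod_i (\prod_j x j ^ A i j) ^ a 0 i = \prod_j x j ^ (a *m A) 0 j.
Proof.
move=> x0; under eq_bigr => i _ do rewrite expfz_prod.
rewrite exchange_big /=; apply: eq_bigr => j _; rewrite mxE.
elim/big_rec2: _ => [|i y z _ ->]; first by rewrite expr0z.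
by rewrite exprz_exp expfzDr // [A i j * _]mulrC.
Qed.

Lemma toric_exprz (a : 'rV[int]_n) : \prod_v toric v ^ a 0 v =
  (\prod_l zeval (G l) ^ (a *m N) 0 l) * \prod_j yvar j ^ (a *m E) 0 j.
Proof.
rewrite -!prod_exprz_mulmx ?zeval_eq0 //; [|exact: yvar_neq0|by move=> l; rewrite zeval_eq0].
by rewrite -big_split; apply: eq_bigr => v _; rewrite /= -expfzMl.
Qed.

Lemma toric_neq0 v : toric v != 0.
Proof.
rewrite mulf_neq0 //; apply/prodf_neq0 => l _; rewrite expfz_neq0 ?yvar_neq0 //.
by rewrite zeval_eq0.
Qed.

Lemma toric_row l : \prod_v toric v ^ M l v = zeval (G l).
Proof.
have := toric_exprz (row l M); rewrite -!row_mul MN ME.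
under eq_bigr => v _ do rewrite mxE.
move=> ->; rewrite [X in _ * X]big1 ?mulr1 => [|j _]; last by rewrite !mxE.
rewrite (bigD1 l) //= !mxE eqxx expr1z big1 ?mulr1 // => i il.
by rewrite !mxE eq_sym (negPf il).
Qed.

(** The parameters are recovered from the coordinates through [E']. This makes each [yvar j] a unit
    once the variables and the [G l] are inverted. *)
Lemma yvar_toric j : yvar j =
  (\prod_v toric v ^ E' j v) * \prod_l zeval (G l) ^ (- (E' *m N) j l).
Proof.
have := toric_exprz (row j E'); rewrite -!row_mul EE.
under eq_bigr => v _ do rewrite mxE.
move=> ->; rewrite mulrAC -big_split /= [X in X * _]big1 ?mul1r => [|l _]; last first.
  by rewrite -expfzDr ?zeval_eq0 // !mxE subrr expr0z.
rewrite (bigD1 j) //= !mxE eqxx expr1z big1 ?mulr1 // => i ij.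
by rewrite !mxE eq_sym (negPf ij).
Qed.

Definition mnm_row (a : 'X_{1..n}) : 'rV[int]_n := \row_v (a v)%:Z.

Lemma toric_mnm (a : 'X_{1..n}) : mmap1 toric a =
  (\prod_l zeval (G l) ^ (mnm_row a *m N) 0 l) *
  \prod_j yvar j ^ (mnm_row a *m E) 0 j.
Proof. by rewrite -toric_exprz; apply: eq_bigr => v _; rewrite mxE. Qed.

(** By [kerE], exponent vectors that differ modulo the rows of [M] have different images under [E],
    hence different [yvar] parts, while the powers of the [G l] are nonzero elements of [k(z)]. *)
Lemma toric_indep (T : eqType) (s : seq T) (m : T -> 'X_{1..n})
  (P : T -> {poly k}) : uniq s ->
  {in s &, forall a b, (exists c, mnm_row (m a) - mnm_row (m b) = c *m M) -> a = b} ->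
  \sum_(a <- s) zeval (P a) * mmap1 toric (m a) = 0 -> {in s, forall a, P a = 0}.
Proof.
move=> us sM s0 a a_s.
pose c b := \prod_l zeval (G l) ^ (mnm_row (m b) *m N) 0 l.
have : zeval (P a) * c a = 0.
  apply: (@zfrac_yvar_indep _ s (fun b => zeval (P b) * c b)
    (fun b => mnm_row (m b) *m E) us) => // [b b' bs b's|b|].
  - by move/eqP; rewrite -subr_eq0 -mulmxBl => /eqP/kerE; apply: sM.
  - apply: zfracM; first exact: zfrac_zeval.
    by apply: zfrac_prod => l; apply/zfrac_exprz/zfrac_zeval.
  - by rewrite -[RHS]s0; apply: eq_bigr => b _; rewrite toric_mnm mulrA.
move/eqP; rewrite mulf_eq0 zeval_eq0 => /orP[/eqP//|].
rewrite prodf_seq_eq0 => /hasP[l _ /=].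
by rewrite expfz_eq0 zeval_eq0 (negPf (G0 l)) andbF.
Qed.

End Toric.

(** * Monomials graded by blocks of variables *)

(** The shift [t] has to be 0 modulo every [d i] with [i != l] and -1 modulo [d l]; one Bezout
    relation between [d l] and the product of the others provides it. *)
Lemma coprime_family_crt (I : finType) (d : I -> nat) (l : I) :
  (forall i j, i != j -> coprime (d i) (d j)) ->
  exists (t : int) (a : I -> int), forall i, a i * (d i)%:Z = t + (i == l)%:Z.
Proof.
move=> cop; pose D := (\prod_(i | i != l) d i)%N.
have : coprimez (d l) D.
  rewrite coprimezE /=; apply: (big_ind (coprime (d l))); first exact: coprimen1.
    by move=> x y dx dy; rewrite coprimeMr dx.
  by move=> i il; rewrite cop // eq_sym.
move=> /coprimezP[[u v] /= uv]; exists (- v * D%:Z).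
exists (fun i => if i == l then u else - v * (\prod_(j | (j != l) && (j != i)) d j)%N%:Z).
move=> i; case: eqP => [->|/eqP il]; first by rewrite -[X in _ + X]uv; ring.
by rewrite [D](bigD1 i) //= PoszM addr0; ring.
Qed.

Section Blocks.
Variables (r n : nat) (bl : 'I_n -> 'I_r.+1) (be : 'I_n -> nat).

Definition bmon (l : 'I_r.+1) : 'X_{1..n} :=
  [multinom (if bl v == l then be v else 0%N) | v < n].

Hypothesis hbl : forall l, exists2 v, bl v = l & (0 < be v)%N.

Lemma bmon_neq0 l : bmon l != 0%MM.
Proof.
have [v vl bv] := hbl l; apply/eqP=> /mnmP/(_ v).
by rewrite mnmE vl eqxx mnm0E => b0; rewrite b0 in bv.
Qed.

(** Some [T_l] dividing the monomial is removed as long as there is one; the total degree drops. The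
    statement uses a finite function and booleans so that [xchoose] can select a quotient. *)
Lemma block_division a : exists e : {ffun 'I_r.+1 -> nat},
  (\sum_l bmon l *+ e l <= a)%MM &&
  [forall l, ~~ (bmon l <= a - \sum_l bmon l *+ e l)%MM].
Proof.
have [d] := ubnP (mdeg a); elim: d a => // d IH a lt_a.
have [/existsP[l la]|] := boolP [exists l, (bmon l <= a)%MM]; last first.
  rewrite negb_exists => /forallP na; exists [ffun=> 0%N].
  rewrite big1 => [|l _]; last by rewrite ffunE mulm0n.
  apply/andP; split; first by apply/mnm_lepP=> v; rewrite mnm0E.
  by apply/forallP=> l; rewrite subm0.
have lb : (0 < mdeg (bmon l))%N by rewrite lt0n mdeg_eq0 bmon_neq0.
have lt_a' : (mdeg (a - bmon l) + mdeg (bmon l) < d.+1)%N by rewrite -mdegD submK.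
have [|e /andP[ea /forallP ne]] := IH (a - bmon l)%MM; first by move: lt_a' lb; lia.
exists [ffun l' => (e l' + (l' == l))%N].
have -> : (\sum_l' bmon l' *+ [ffun l' => (e l' + (l' == l))%N] l' =
           \sum_l' bmon l' *+ e l' + bmon l)%MM.
  rewrite -[in RHS](mulm1n (bmon l)) (bigD1 l) // [in RHS](bigD1 l) //=.
  rewrite ffunE eqxx; under eq_bigr => i il do rewrite ffunE (negPf il) addn0.
  by apply/mnmP=> v; rewrite !(mnmDE, mulmnE); lia.
apply/andP; split; first by apply/mnm_lepP=> v; move/mnm_lepP/(_ v): ea;
  move/mnm_lepP/(_ v): la; rewrite mnmBE mnmDE; lia.
by apply/forallP=> l'; rewrite addmC -submDA; apply: ne.
Qed.

Definition bquo a := xchoose (block_division a).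
Definition brem a := (a - \sum_l bmon l *+ bquo a l)%MM.
Definition bdeg a := (\sum_l bquo a l)%N.

Definition bnormal (m : 'X_{1..n}) := forall l, ~~ (bmon l <= m)%MM.

Lemma brem_normal a : bnormal (brem a).
Proof. by move=> l; have /andP[_ /forallP] := xchooseP (block_division a); apply. Qed.

Lemma bquo_eq a : a = (brem a + \sum_l bmon l *+ bquo a l)%MM.
Proof. by have /andP[le _] := xchooseP (block_division a); rewrite submK. Qed.

Variable i1 : 'I_r.+1.

(** The rows are the exponents of the quotients [T_l / T_i1], whose values are to be prescribed. *)
Definition bmat : 'M[int]_(r, n) :=
  \matrix_(l, v) ((bmon (lift i1 l) v)%:Z - (bmon i1 v)%:Z).

Lemma bmat_row (c : 'rV[int]_r) v :
  (c *m bmat) 0 v = if unlift i1 (bl v) is Some l then c 0 l * (be v)%:Z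
                    else - (\sum_l c 0 l) * (be v)%:Z.
Proof.
rewrite mxE; case: unliftP => [l vl|vl]; last first.
  rewrite mulNr -mulrN mulr_suml; apply: eq_bigr => l _.
  by rewrite !mxE !mnmE vl eqxx (negPf (neq_lift _ _)) sub0r.
rewrite (bigD1 l) //= big1 => [|l' l'l]; last first.
  rewrite !mxE !mnmE vl (inj_eq lift_inj) eq_sym (negPf l'l).
  by rewrite eq_sym (negPf (neq_lift _ _)) subrr mulr0.
by rewrite !mxE !mnmE vl eqxx eq_sym (negPf (neq_lift _ _)) subr0 addr0.
Qed.

(** If [c] were positive then [T_l] would divide [m], and if negative, [m']. *)
Lemma bnormal_diff (m m' : 'X_{1..n}) l (c : int) : bnormal m -> bnormal m' ->
  (forall v, bl v = l -> (m v)%:Z - (m' v)%:Z = c * (be v)%:Z) -> c = 0.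
Proof.
move=> nm nm' h; have [c0|c0|//] := Order.TotalTheory.ltgtP c 0.
  case/negP: (nm' l); apply/mnm_lepP=> v; rewrite mnmE.
  by case: eqP => // /h; nia.
case/negP: (nm l); apply/mnm_lepP=> v; rewrite mnmE.
by case: eqP => // /h; nia.
Qed.

(** On a block other than [i1] the congruence makes [m - m'] a multiple of the block exponents, so
    normality forces the coefficient of that row to be 0. On block [i1] the same argument then
    applies to [e' - e]. *)
Lemma bkey_inj m e m' e' : bnormal m -> bnormal m' ->
  (exists c, mnm_row (m + bmon i1 *+ e)%MM - mnm_row (m' + bmon i1 *+ e')%MM =
             c *m bmat) ->
  (m, e) = (m', e').
Proof.
move=> nm nm' [c /rowP h].
have c0 l : c 0 l = 0.
  apply: (@bnormal_diff m m' (lift i1 l)) => // v vl.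
  have := h v; rewrite bmat_row vl liftK !mxE !mnmDE !mulmnE mnmE vl.
  by rewrite eq_sym (negPf (neq_lift _ _)) !mul0n !addn0.
have h0 v : (m v + bmon i1 v * e)%N = (m' v + bmon i1 v * e')%N.
  have := h v; rewrite !mxE !mnmDE !mulmnE big1 => [|l _]; last by rewrite c0 mul0r.
  lia.
have ee : e'%:Z - e%:Z = 0.
  apply: (@bnormal_diff m m' i1) => // v vl.
  by have := h0 v; rewrite mnmE vl eqxx; nia.
have {}ee : e = e' by lia.
by congr (_, _) => //; apply/mnmP=> v; have := h0 v; rewrite ee; lia.
Qed.

(** Column [l] of the inverse is the Bezout vector [b] rescaled on block [i] by [a l i], so it pairs
    with the exponents of [T_i] to [t + [i = lift i1 l]]; [t] cancels between the two terms of a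
    row. *)
Lemma bmat_right_inverse (b : 'I_n -> int) (d : 'I_r.+1 -> nat) :
  (forall i j, i != j -> coprime (d i) (d j)) ->
  (forall l, \sum_(v | bl v == l) b v * (be v)%:Z = (d l)%:Z) ->
  exists N, bmat *m N = 1%:M.
Proof.
move=> cop bd.
have /fin_all_exists[a ha] : forall l : 'I_r, exists a : 'I_r.+1 -> int,
  exists t : int, forall i, a i * (d i)%:Z = t + (i == lift i1 l)%:Z.
  by move=> l; have [t [a ?]] := coprime_family_crt (lift i1 l) cop; exists a, t.
exists (\matrix_(v, l) (a l (bl v) * b v)); apply/matrixP=> l l'; rewrite !mxE.
have bsum i : \sum_v (bmon i v)%:Z * (a l' (bl v) * b v) = a l' i * (d i)%:Z.
  rewrite -bd mulr_sumr [RHS]big_mkcond; apply: eq_bigr => v _ /=.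
  by rewrite mnmE; case: eqP => [->|_]; ring.
under eq_bigr => v _ do rewrite !mxE mulrBl.
rewrite sumrB !bsum; have [t ta] := ha l'; rewrite !ta.
rewrite (inj_eq lift_inj) (negPf (neq_lift _ _)) /=.
by rewrite addr0 addrAC subrr add0r; case: eqP.
Qed.

End Blocks.

(** * The kernel of a monomial parametrization *)

Section Mmap1.
Variables (n : nat) (R : comNzRingType) (h : 'I_n -> R).

Lemma mmap1D (a b : 'X_{1..n}) : mmap1 h (a + b)%MM = mmap1 h a * mmap1 h b.
Proof. by apply: commr_mmap1_M => i x; apply: mulrC. Qed.

Lemma mmap1Mn (a : 'X_{1..n}) e : mmap1 h (a *+ e)%MM = mmap1 h a ^+ e.
Proof.
elim: e => [|e IH]; first by rewrite mulm0n mmap11.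
by rewrite mulmS mmap1D IH exprS.
Qed.

Lemma mmap1_sum (I : Type) (s : seq I) (F : I -> 'X_{1..n}) :
  mmap1 h (\sum_(i <- s) F i)%MM = \prod_(i <- s) mmap1 h (F i).
Proof. by elim: s => [|i s IH]; rewrite ?big_nil ?mmap11 // !big_cons mmap1D IH. Qed.

End Mmap1.

Section Homogenize.
Variables (k : fieldType) (R : comAlgType k) (x y : R).
Implicit Types (p g : {poly k}).

(** The binary form [y^E p(x/y)], for [p] of degree at most [E]. *)
Definition homogenize E p := \sum_(i < E.+1) p`_i *: (x ^+ i * y ^+ (E - i)).

Lemma homogenizeD E p g : homogenize E (p + g) = homogenize E p + homogenize E g.
Proof. by rewrite -big_split; apply: eq_bigr => i _; rewrite coefD scalerDl. Qed.

Lemma homogenizeZ E c p : homogenize E (c *: p) = c *: homogenize E p.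
Proof. by rewrite scaler_sumr; apply: eq_bigr => i _; rewrite coefZ scalerA. Qed.

Lemma homogenize0 E : homogenize E 0 = 0.
Proof. by rewrite -(scale0r 0) homogenizeZ scale0r. Qed.

Lemma homogenize_sum E (I : Type) (s : seq I) (P : pred I) (F : I -> {poly k}) :
  homogenize E (\sum_(i <- s | P i) F i) = \sum_(i <- s | P i) homogenize E (F i).
Proof. exact: (big_morph _ (homogenizeD E) (homogenize0 E)). Qed.

Lemma homogenizeM E p g : (size g <= 2)%N -> (size p <= E.+1)%N ->
  homogenize E.+1 (g * p) = (g`_0 *: y + g`_1 *: x) * homogenize E p.
Proof.
move=> sg sp.
have -> : g = (g`_0)%:P + (g`_1)%:P * 'X.
  apply/polyP=> i; rewrite coefD coefC coefCM coefX.
  case: i => [|[|i]]; rewrite ?mulr0 ?mulr1 ?addr0 ?add0r //.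
  by rewrite nth_default // (leq_trans sg).
rewrite !coefD !coefC !coefCM !coefX /= mulr0 mulr1 add0r addr0.
rewrite mulrDl -mulrA !mul_polyC homogenizeD !homogenizeZ mulrDl -!scalerAl.
congr (_ *: _ + _ *: _).
  rewrite /homogenize big_ord_recr /= nth_default // scale0r addr0 mulr_sumr.
  by apply: eq_bigr => i _; rewrite -scalerAr mulrCA -exprS subSn // -ltnS.
rewrite /homogenize big_ord_recl coefXM /= scale0r add0r mulr_sumr.
by apply: eq_bigr => i _; rewrite coefXM /= -scalerAr mulrA -exprS.
Qed.

End Homogenize.

Section Kernel.
Variables (k : fieldType) (r n q : nat).
Variables (bl : 'I_n -> 'I_r.+1) (be : 'I_n -> nat).
Hypothesis hbl : forall l, exists2 v, bl v = l & (0 < be v)%N.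
Local Notation L := {fraction {mpoly k[q.+1]}}.
Local Notation tofrac := (@FracField.tofrac {mpoly k[q.+1]}).
Local Notation bm := (bmon bl be).
Local Notation constL := (tofrac \o @mpolyC q.+1 k).
Variables (i1 : 'I_r.+1) (G : 'I_r.+1 -> {poly k}).

Section KernelIdeal.
Variables (x : {mpoly k[n]}) (J : {mpoly k[n]} -> Prop).
Hypotheses (J0 : J 0) (JD : forall a b, J a -> J b -> J (a + b)).
Hypothesis (JM : forall a b, J b -> J (a * b)).
Hypothesis sG : forall l, (size (G l) <= 2)%N.
Local Notation y := ('X_[bm i1] : {mpoly k[n]}).
Hypothesis JG : forall l, J ('X_[bm l] - ((G l)`_0 *: y + (G l)`_1 *: x)).

Lemma ideal_sum (I : Type) (s : seq I) (P : pred I) (F : I -> {mpoly k[n]}) :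
  (forall i, J (F i)) -> J (\sum_(i <- s | P i) F i).
Proof. by move=> h; elim/big_ind: _. Qed.

(** Modulo [J] each [T_l] is the linear form attached to [G l], so a product of them is the form
    attached to the product. The size bound is carried along because [homogenizeM] requires it. *)
Lemma homogenize_block_prod (e : 'I_r.+1 -> nat) :
  J (\prod_l 'X_[bm l] ^+ e l - homogenize x y (\sum_l e l)%N (\prod_l G l ^+ e l)) /\
  (size (\prod_l G l ^+ e l)%R <= (\sum_l e l).+1)%N.
Proof.
pose Q t E p := J (t - homogenize x y E p) /\ (size p <= E.+1)%N.
rewrite -/(Q _ _ _); have QM l t E p : Q t E p -> Q ('X_[bm l] * t) E.+1 (G l * p).
  move=> [Jt sp]; split; last first.
    by have := size_polyMleq (G l) p; have := sG l; move: sp; lia.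
  rewrite homogenizeM //; set c := (G l)`_0 *: y + (G l)`_1 *: x; set h := homogenize _ _ _ _ in Jt *.
  rewrite (_ : _ - _ = t * ('X_[bm l] - c) + c * (t - h)); last by ring.
  by apply: JD; apply: JM => //; apply: JG.
elim/big_rec3: _ => [|l t E p _].
  split; last by rewrite size_poly1.
  by rewrite /homogenize big_ord1 coef1 /= !expr0 scale1r mulr1 subrr.
elim: (e l) => [|d IH] Qt; first by rewrite !expr0 !mul1r.
by rewrite !exprS -!mulrA addSn; apply/QM/IH.
Qed.

Lemma mnm_homogenize a : J ('X_[a] - 'X_[brem hbl a] *
  homogenize x y (bdeg hbl a) (\prod_l G l ^+ bquo hbl a l)).
Proof.
rewrite {1}(bquo_eq hbl a) mpolyXD -mprodXnE -mulrBr; apply: JM.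
exact: (homogenize_block_prod _).1.
Qed.

Variable h : 'I_n -> L.
Hypothesis hG : forall l, mmap1 h (bm l) = zeval q (G l) * mmap1 h (bm i1).
Hypothesis h_indep : forall (s : seq ('X_{1..n} * nat)) (P : _ -> {poly k}),
  uniq s -> {in s, forall b, bnormal bl be b.1} ->
  \sum_(b <- s) zeval q (P b) * mmap1 h (b.1 + bm i1 *+ b.2)%MM = 0 ->
  {in s, forall b, P b = 0}.

Lemma mmap1_brem a : mmap1 h a = zeval q (\prod_l G l ^+ bquo hbl a l) *
  mmap1 h (brem hbl a + bm i1 *+ bdeg hbl a)%MM.
Proof.
rewrite {1}(bquo_eq hbl a) !mmap1D mulrCA; congr (_ * _).
rewrite mmap1_sum mmap1Mn /bdeg -prodrXr rmorph_prod -big_split.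
by apply: eq_bigr => l _; rewrite mmap1Mn hG exprMn rmorphXn.
Qed.

(** The terms of [f] are grouped by remainder and total block degree. In [L] a group becomes one
    polynomial [P b] in [z] times a monomial, and by [h_indep] all [P b] vanish. Modulo [J] the same
    group is the remainder times the homogenization of the same [P b], hence 0. *)
Theorem blocks_kernel f : mmap constL h f = 0 -> J f.
Proof.
pose key a := (brem hbl a, bdeg hbl a).
pose P b := \sum_(a <- msupp f | key a == b) f@_a *: \prod_l G l ^+ bquo hbl a l.
pose s := undup (map key (msupp f)).
have keyS a : a \in msupp f -> key a \in s by move=> af; rewrite mem_undup map_f.
have part (V : zmodType) (F : 'X_{1..n} -> V) : \sum_(a <- msupp f) F a =
    \sum_(b <- s) \sum_(a <- msupp f | key a == b) F a.
  rewrite (exchange_big_dep predT) //= big_seq [RHS]big_seq; apply: eq_bigr => a /keyS ks.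
  by rewrite big_mkcond (bigD1_seq (key a)) ?undup_uniq //= eqxx big1 ?addr0 // => b /negPf;
    rewrite eq_sym => ->.
move=> f0; have P0 : {in s, forall b, P b = 0}.
  apply: h_indep; first exact: undup_uniq.
    by move=> b; rewrite mem_undup => /mapP[a _ ->]; apply: brem_normal.
  rewrite -[RHS]f0 /mmap part; apply: eq_bigr => b _.
  rewrite rmorph_sum mulr_suml; apply: eq_bigr => a /eqP <- /=.
  by rewrite (mmap1_brem a) -mul_polyC rmorphM /= zevalC mulrA.
rewrite [f]mpolyE.
(* The subtracted terms add up to 0, group by group, and each remaining difference lies in [J] by
   [mnm_homogenize]. *)
rewrite (_ : \sum_(a <- _) _ = \sum_(a <- msupp f) f@_a *: ('X_[a] -
  'X_[brem hbl a] * homogenize x y (bdeg hbl a) (\prod_l G l ^+ bquo hbl a l))); last first.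
  rewrite (eq_bigr _ (fun _ _ => scalerBr _ _ _)) sumrB -[LHS]subr0; congr (_ - _).
  rewrite part big_seq big1 // => b bs.
  rewrite (eq_bigr (fun a => 'X_[b.1] * homogenize x y b.2
    (f@_a *: \prod_l G l ^+ bquo hbl a l))); last first.
    by move=> a /eqP <- /=; rewrite homogenizeZ scalerAr.
  by rewrite -mulr_sumr -homogenize_sum -/(P b) P0 // homogenize0 mulr0.
by apply: ideal_sum => a; rewrite -mul_mpolyC; apply/JM/mnm_homogenize.
Qed.

End KernelIdeal.

Variable N : 'M[int]_(n, r).
Variables (E : 'M[int]_(n, q)).
Hypotheses (MN : bmat bl be i1 *m N = 1%:M) (ME : bmat bl be i1 *m E = 0).
Hypothesis kerE : forall a : 'rV[int]_n, a *m E = 0 ->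
  exists c, a = c *m bmat bl be i1.

(* A block with G l = 0 is sent to 0: its variables with a positive exponent are
   killed, and the torus is built with 1 in place of G l. *)
Definition active_poly l : {poly k} := if G l == 0 then 1 else G l.
Definition killed v := (G (bl v) == 0) && (0 < be v)%N.
Definition block_point v : L :=
  if killed v then 0 else toric N E (fun l => active_poly (lift i1 l)) v.

Hypothesis Gi1 : G i1 = 1.
Hypothesis kill1 : forall v, killed v -> bm (bl v) = U_(v)%MM.

Lemma active_poly_neq0 l : active_poly l != 0.
Proof. by rewrite /active_poly; case: ifPn; rewrite ?oner_neq0. Qed.

Local Notation w := (toric N E (fun l => active_poly (lift i1 l))).

Lemma block_point_neq0 v : ~~ killed v -> block_point v != 0.
Proof. by rewrite /block_point => /negPf ->; apply/toric_neq0 => l; apply: active_poly_neq0. Qed.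

Lemma mmap1_block_point (a : 'X_{1..n}) : (forall v, killed v -> a v = 0%N) ->
  mmap1 block_point a = mmap1 w a.
Proof.
move=> ka; apply: eq_bigr => v _; rewrite /block_point.
by case: ifP => // /ka ->; rewrite !expr0.
Qed.

Lemma killed_base v : killed v -> bm i1 v = 0%N.
Proof. by rewrite /killed mnmE; case: (bl v =P i1) => // ->; rewrite Gi1 oner_eq0. Qed.

Lemma toric_block l : mmap1 w (bm l) = zeval q (active_poly l) * mmap1 w (bm i1).
Proof.
have w0 v : w v != 0 by apply/toric_neq0 => l'; apply: active_poly_neq0.
have [l' ->|->] := unliftP i1 l; last first.
  by rewrite /active_poly Gi1 oner_eq0 rmorph1 mul1r.
rewrite -(toric_row MN ME (fun l => active_poly_neq0 (lift i1 l)) l').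
rewrite /mmap1 -big_split; apply: eq_bigr => v _ /=.
by rewrite !mxE !exprnP -expfzDr // subrK.
Qed.

Lemma block_pointG l : mmap1 block_point (bm l) = zeval q (G l) * mmap1 block_point (bm i1).
Proof.
rewrite (@mmap1_block_point (bm i1)); last exact: killed_base.
have [Gl0|Gl0] := eqVneq (G l) 0.
  have [v vl bv] := hbl l; rewrite Gl0 rmorph0 mul0r.
  have kv : killed v by rewrite /killed vl Gl0 eqxx.
  by rewrite -vl kill1 // mmap1U /block_point kv.
rewrite mmap1_block_point => [|v /andP[Gv _]].
  by rewrite toric_block /active_poly (negPf Gl0).
by rewrite mnmE; case: eqP => // vl; rewrite -vl Gv in Gl0.
Qed.

(** By [kill1] a killed variable is the whole monomial of its block, so it occurs in no normal
    monomial; on those [block_point] agrees with the torus point. *)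
Lemma block_point_indep (s : seq ('X_{1..n} * nat)) (P : _ -> {poly k}) :
  uniq s -> {in s, forall b, bnormal bl be b.1} ->
  \sum_(b <- s) zeval q (P b) * mmap1 block_point (b.1 + bm i1 *+ b.2)%MM = 0 ->
  {in s, forall b, P b = 0}.
Proof.
move=> us ns s0; pose Ga l := active_poly (lift i1 l).
apply: (toric_indep kerE (fun l => active_poly_neq0 (lift i1 l))
  (m := fun b => (b.1 + bm i1 *+ b.2)%MM) us).
  move=> [m e] [m' e'] bs bs'; apply: bkey_inj => //; first exact: (ns _ bs).
  exact: (ns _ bs').
rewrite -[RHS]s0 big_seq [RHS]big_seq; apply: eq_bigr => b bs; congr (_ * _).
rewrite mmap1_block_point // => v kv; rewrite mnmDE mulmnE killed_base // mul0n addn0.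
apply/eqP; apply: contraTT (ns _ bs (bl v)); rewrite kill1 // negbK => bv.
by rewrite lep1mP.
Qed.

End Kernel.

(** * Unique factorization in a quotient and Nagata's criterion *)

Section QuotientUFD.
Variables (R : comNzRingType) (L : fieldType) (phi : {rmorphism R -> L}).
Variable I : R -> Prop.
Hypothesis kerI : forall x, I x <-> phi x = 0.

(** Congruence modulo [I] becomes equality in the field [L], so cancellation is available
    throughout. *)
Lemma kerB a b : I (a - b) <-> phi a = phi b.
Proof.
by rewrite kerI rmorphB; split=> [/eqP|->]; rewrite ?subrr // subr_eq0 => /eqP.
Qed.

Lemma unitQE u : unitQ I u <-> exists v, phi u * phi v = 1.
Proof.
by split=> -[v]; [move/kerB|move=> e; exists v; apply/kerB; move: e];
  rewrite rmorphM rmorph1 => e //; exists v.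
Qed.

Lemma dvdQE a b : dvdQ I a b <-> exists c, phi b = phi a * phi c.
Proof.
by split=> -[c]; [move/kerB|move=> e; exists c; apply/kerB; move: e];
  rewrite rmorphM => e //; exists c.
Qed.

Lemma assocQE a b :
  assocQ I a b <-> exists2 u, unitQ I u & phi b = phi u * phi a.
Proof.
split=> [[u [uu /kerB]]|[u uu e]]; first by rewrite rmorphM; exists u.
by exists u; split=> //; apply/kerB; rewrite rmorphM.
Qed.

Lemma domainQ_ker : domainQ I.
Proof.
split=> [/kerI/eqP|a b /kerI/eqP]; first by rewrite rmorph1 oner_eq0.
by rewrite rmorphM mulf_eq0 => /orP[] /eqP/kerI; [left|right].
Qed.

Lemma phi_neq0 a : ~ I a -> phi a != 0.
Proof. by move=> na; apply/eqP=> /kerI. Qed.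

Lemma unitQM a b : unitQ I a -> unitQ I b -> unitQ I (a * b).
Proof.
move=> /unitQE[c ac] /unitQE[d bd]; apply/unitQE; exists (c * d).
by rewrite !rmorphM mulrACA ac bd mulr1.
Qed.

Lemma unitQ_phi a b : phi a = phi b -> unitQ I a -> unitQ I b.
Proof. by move=> e /unitQE[c ac]; apply/unitQE; exists c; rewrite -e. Qed.

Lemma unitQ_dvd a b : unitQ I (a * b) -> unitQ I a.
Proof.
by move=> /unitQE[c e]; apply/unitQE; exists (b * c); rewrite rmorphM mulrA -rmorphM.
Qed.

Lemma primeQ_irredQ p : primeQ I p -> irredQ I p.
Proof.
move=> [p0 [pu pP]]; split=> //; split=> // b c /kerB e.
have {p0}p0 := phi_neq0 p0.
have aux x y : phi p = phi (x * y) -> dvdQ I p x -> unitQ I y.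
  move=> exy /dvdQE[d xd]; apply/unitQE; exists d; apply: (mulfI p0).
  by rewrite mulr1 [in RHS]exy rmorphM xd mulrCA mulrAC mulrC mulrAC.
have [|pb|pc] := pP b c; first by apply/dvdQE; exists 1; rewrite rmorph1 mulr1 e.
  by right; apply: (aux b).
by left; apply: (aux c); rewrite // mulrC.
Qed.

Lemma primeQ_assoc p u q : primeQ I p -> unitQ I u -> phi q = phi p * phi u ->
  primeQ I q.
Proof.
move=> [p0 [pu pP]] uu eq; have /unitQE[v uv] := uu.
have u0 : phi u != 0 by apply: contra_eq_neq uv => ->; rewrite mul0r eq_sym oner_neq0.
split.
  by move=> /kerI/eqP; rewrite eq mulf_eq0 (negPf (phi_neq0 p0)) (negPf u0).
split; first by move=> qu; apply: pu; apply: (@unitQ_dvd p u); apply: (unitQ_phi _ qu); rewrite rmorphM.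
have pq a : dvdQ I p a -> dvdQ I q a.
  move=> /dvdQE[c e]; apply/dvdQE; exists (v * c).
  by rewrite e eq rmorphM mulrA -(mulrA (phi p)) uv mulr1.
move=> a b /dvdQE[c e]; have [|/pq|/pq] := pP a b; [|by left|by right].
by apply/dvdQE; exists (u * c); rewrite e eq rmorphM mulrA.
Qed.

Lemma primeQ_dvd_prod p (s : seq R) : primeQ I p -> dvdQ I p (\prod_(x <- s) x) ->
  exists2 x, x \in s & dvdQ I p x.
Proof.
move=> [p0 [pu pP]]; elim: s => [|x s IH].
  by rewrite big_nil => /dvdQE[c]; rewrite rmorph1 => e; case: pu; apply/unitQE; exists c.
rewrite big_cons => /pP[px|/IH[y ys py]]; first by exists x; rewrite ?mem_head.
by exists y; rewrite // inE ys orbT.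
Qed.

Hypothesis fac : forall a, ~ I a -> exists u (s : seq R),
  [/\ unitQ I u, forall x, x \in s -> primeQ I x & phi a = phi (u * \prod_(x <- s) x)].

(** One prime of a factorization of [q] is split off; irreducibility makes the cofactor a unit. *)
Lemma irredQ_primeQ q : irredQ I q -> primeQ I q.
Proof.
move=> [q0 [qu qi]]; have [u [[|p s] [uu sp e]]] := fac q0.
  by case: qu; apply: (unitQ_phi (esym e)); rewrite big_nil mulr1.
have pp := sp p (mem_head _ _); move: e; rewrite big_cons mulrCA => e.
have [pu|xu] := qi p _ ((kerB _ _).2 e); first by case: pp => _ [].
by apply: (primeQ_assoc pp xu); rewrite e rmorphM.
Qed.

Theorem UFDQ_ker : UFDQ I.
Proof.
split; first exact: domainQ_ker.
split=> [a a0 au|].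
  have [u [s [uu sp e]]] := fac a0; exists s; split.
    by move=> x /sp; apply: primeQ_irredQ.
  have /unitQE[v uv] := uu; apply/assocQE; exists v.
    by apply/unitQE; exists u; rewrite mulrC.
  by rewrite e rmorphM mulrA (mulrC (phi v)) uv mul1r.
elim=> [|x s IH] t si ti /assocQE[u uu]; rewrite ?big_nil ?rmorph1 ?mulr1 => e.
  case: t ti e => [|y t] ti; first by split=> //; exists [::].
  rewrite big_cons => e; have [_ [yu _]] := ti y (mem_head _ _).
  by case: yu; apply: (@unitQ_dvd _ (\prod_(x <- t) x)); apply: (unitQ_phi (esym e)).
have xi := si x (mem_head _ _); have xp := irredQ_primeQ xi.
have x0 : phi x != 0 by apply: phi_neq0; case: xi.
(* The prime [x] divides some [y] of [t], and [y = x * c] with [c] a unit; [x] is cancelled from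
   both products and [c] is absorbed into the unit. *)
have [|y yt xy] := @primeQ_dvd_prod x t xp.
  by apply/dvdQE; exists (u * \prod_(y <- s) y); rewrite e big_cons !rmorphM mulrCA.
have /dvdQE[c yc] := xy; have yi := ti y yt.
have cu : unitQ I c.
  have [_ [_ /(_ x c)[]]] := yi; rewrite ?kerB ?rmorphM //.
  by case: xi => _ [].
have [|||st [t' [tt' as']]] := IH (rem y t).
- by move=> z zs; apply: si; rewrite inE zs orbT.
- by move=> z /mem_rem; apply: ti.
- have /unitQE[c' cc'] := cu; apply/assocQE; exists (u * c').
    by apply: unitQM => //; apply/unitQE; exists c; rewrite mulrC.
  move: e; rewrite (big_rem y yt) /= big_cons !rmorphM yc -mulrA [phi u * _]mulrCA.
  by move/(mulfI x0) => e; rewrite mulrAC -e mulrAC cc' mul1r.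
split; first by rewrite /= st size_rem // prednK //; case: (t) yt.
exists (y :: t'); split.
  by rewrite (perm_trans (perm_to_rem yt)) // perm_cons.
case=> [|i] /=; last by rewrite ltnS; apply: as'.
by move=> _; apply/assocQE; exists c; rewrite // yc mulrC.
Qed.

End QuotientUFD.

(* Nagata's criterion: [R/I] is compared with the factorial ring [P] inside
   the field [L], through the localization of [R/I] at the primes in [T]. *)
Section Nagata.
Variables (R : comNzRingType) (L : fieldType) (phi : {rmorphism R -> L}).
Variable I : R -> Prop.
Hypothesis kerI : forall x, I x <-> phi x = 0.
Variables (P : idomainType) (j : {rmorphism P -> L}) (T : seq R).
Hypotheses (j0 : forall p, j p = 0 -> p = 0) (facP : is_factorial P).
Hypothesis primeT : forall t, t \in T -> primeQ I t.

(** The localization of [R/I] at the products of [T]. The denominator is kept as a list so that its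
    primes can be cancelled one at a time. *)
Definition in_loc (x : L) := exists (s : seq R) (c : R),
  {subset s <= T} /\ x * phi (\prod_(t <- s) t) = phi c.

Hypothesis locP : forall p, in_loc (j p).
Hypothesis denP : forall c, exists s : P,
  [/\ s != 0, in_loc (j s)^-1 & exists p, phi c * j s = j p].
Hypothesis sepT : forall a, ~ I a -> exists d, forall (s : seq R) c, {subset s <= T} ->
  phi a = phi (\prod_(t <- s) t) * phi c -> (size s <= d)%N.

Local Notation dvd := (dvdQ I).
Local Notation dvdE := (dvdQE kerI).

Lemma phi_prodT_neq0 s : {subset s <= T} -> phi (\prod_(t <- s) t) != 0.
Proof.
move=> sT; rewrite rmorph_prod prodf_seq_neq0; apply/allP=> t /sT/primeT[t0 _].
exact: (phi_neq0 kerI).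
Qed.

Lemma in_locM x y : in_loc x -> in_loc y -> in_loc (x * y).
Proof.
move=> [s [c [sT e]]] [s' [c' [s'T e']]]; exists (s ++ s'), (c * c').
split=> [t|]; first by rewrite mem_cat => /orP[/sT|/s'T].
by rewrite big_cat !rmorphM mulrACA e e'.
Qed.

Lemma in_loc_phi c : in_loc (phi c).
Proof. by exists [::], c; rewrite big_nil rmorph1 mulr1. Qed.

Lemma in_loc_prodT s : {subset s <= T} -> in_loc (phi (\prod_(t <- s) t))^-1.
Proof.
move=> sT; exists s, 1; split=> //.
by rewrite mulVf ?rmorph1 // phi_prodT_neq0.
Qed.

Definition coprimeT a := forall t, t \in T -> ~ dvd t a.

(** Members of [T] are divided out greedily; [sepT] bounds their number, so [d - size s] measures
    what is left. *)
Lemma stripT a : ~ I a -> exists s b,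
  [/\ {subset s <= T}, phi a = phi (\prod_(t <- s) t) * phi b, coprimeT b & ~ I b].
Proof.
move=> a0; have [d ad] := sepT a0.
suff aux m s b : (d - size s <= m)%N -> {subset s <= T} ->
    phi a = phi (\prod_(t <- s) t) * phi b -> exists s b,
  [/\ {subset s <= T}, phi a = phi (\prod_(t <- s) t) * phi b, coprimeT b & ~ I b].
  by apply: (aux d [::] a) => //; rewrite ?leq_subr // big_nil rmorph1 mul1r.
elim: m s b => [|m IH] s b le_m sT e.
  exists s, b; split=> // [t tT /dvdE[c bc]|/kerI b0]; last first.
    by apply: a0; apply/kerI; rewrite e b0 mulr0.
  have sT' : {subset t :: s <= T} by move=> t'; rewrite inE => /orP[/eqP->|/sT].
  suff /(ad _ c sT') /= : phi a = phi (\prod_(i <- t :: s) i) * phi c.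
    by move: le_m => /=; lia.
  by rewrite e bc big_cons rmorphM mulrA (mulrC (phi t)).
have [[t tT /dvdE[c bc]]|nt] := classic (exists2 t, t \in T & dvd t b).
  have sT' : {subset t :: s <= T} by move=> t'; rewrite inE => /orP[/eqP->|/sT].
  apply: (IH (t :: s) c) => //=; first by move: le_m => /=; lia.
  by rewrite e bc big_cons rmorphM mulrA (mulrC (phi t)).
exists s, b; split=> // [t tT tb|/kerI b0]; first by apply: nt; exists t.
by apply: a0; apply/kerI; rewrite e b0 mulr0.
Qed.

(** Each prime of the denominator of [x] divides [c] times the numerator but not [c], so it cancels
    against the numerator. *)
Lemma coprimeT_quot a c x : coprimeT c -> ~ I c -> in_loc x ->
  phi a = phi c * x -> exists d, phi d = x.
Proof.
move=> cT c0 [s [b [sT]]]; elim: s b sT => [|t s IH] b sT.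
  by rewrite big_nil rmorph1 mulr1 => ->; exists b.
rewrite big_cons rmorphM => e ax.
have tT := sT t (mem_head _ _); have [t0 [_ tP]] := primeT tT.
have [|/(cT t tT)//|/dvdE[d bd]] := tP c b.
  apply/dvdE; exists (a * \prod_(t <- s) t).
  by rewrite !rmorphM -e ax; ring.
apply: (IH d) => // [t' t's|]; first by apply: sT; rewrite inE t's orbT.
by apply: (mulfI (phi_neq0 kerI t0)); rewrite -bd -e mulrCA.
Qed.

(** Divisibility by [a] is moved to [P] by clearing denominators, decided there by the prime [p],
    and moved back by [coprimeT_quot]. Denominators are invertible in the localization and so are
    not divisible by [p]. *)
Lemma prime_in_loc p a : rprime p -> ~ in_loc (j p)^-1 -> coprimeT a -> ~ I a ->
  forall w, in_loc w -> in_loc w^-1 -> phi a = j p * w -> primeQ I a.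
Proof.
move=> [p0 pu pP] pn aT a0 w lw lwV e; have phia0 := phi_neq0 kerI a0.
have jp0 : j p != 0 by apply: contraNneq p0 => /j0 ->.
have w0 : w != 0 by apply: contraNneq phia0 => w0; rewrite e w0 mulr0.
have dvdV s : s != 0 -> in_loc (j s)^-1 -> ~ rdvd p s.
  move=> s0 ls [x sx]; apply: pn.
  have x0 : j x != 0 by apply: contraNneq s0 => /j0 x0; rewrite sx x0 mulr0.
  rewrite (_ : (j p)^-1 = (j s)^-1 * j x); first exact: in_locM.
  by rewrite sx rmorphM invfM -mulrA mulVf ?mulr1.
have dvd_a b sb pb : sb != 0 -> in_loc (j sb)^-1 -> phi b * j sb = j pb ->
    rdvd p pb -> dvd a b.
  move=> sb0 lsb eb [x pbx].
  have jsb0 : j sb != 0 by apply: contraNneq sb0 => /j0 ->.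
  have [||d ed] := @coprimeT_quot b a (j x * w^-1 * (j sb)^-1) aT a0.
  - by apply: in_locM => //; apply: in_locM.
  - apply: (mulIf jsb0); rewrite eb pbx rmorphM e; field.
    by rewrite w0 jsb0.
  apply/dvdE; exists d; rewrite ed; apply: (mulIf jsb0).
  by rewrite eb pbx rmorphM e; field; rewrite w0 jsb0.
split=> //; split.
  move=> /(unitQE kerI)[v av]; apply: pn.
  rewrite (_ : _^-1 = w * phi v); first by apply: in_locM => //; apply: in_loc_phi.
  by apply: (mulfI jp0); rewrite divff // mulrA -e.
move=> b c /dvdE[d ed].
have [sb [sb0 lsb [pb eb]]] := denP b; have [sc [sc0 lsc [pc ec]]] := denP c.
have [sd [sd0 lsd [pd epd]]] := denP d.
have [s [x [sT ew]]] := lw; have [s1 [s10 ls1 [p1 e1]]] := denP (\prod_(t <- s) t).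
have [s2 [s20 ls2 [p2 e2]]] := denP x.
have jn0 y : y != 0 -> j y != 0 by apply: contraNneq => /j0 ->.
have tn0 := phi_prodT_neq0 sT; set t := \prod_(t <- s) t in ew e1 tn0.
have p10 : p1 != 0.
  apply: contraTneq (mulf_neq0 tn0 (jn0 _ s10)) => p10.
  by rewrite e1 p10 rmorph0 eqxx.
(* Over [P] the factor [w] is [p2 * s1 / (s2 * p1)], so [b * c = a * d] becomes this divisibility.
   The last three factors are units of the localization, so [p] divides [pb] or [pc]. *)
have : rdvd p (pb * pc * (sd * s2 * p1)).
  exists (p2 * s1 * pd * sb * sc).
  have inj u v : j u = j v -> u = v.
    by move=> euv; apply/eqP; rewrite -subr_eq0; apply/eqP/j0; rewrite rmorphB euv subrr.
  apply: inj; rewrite !rmorphM -eb -ec -epd -e1 -e2 -ew.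
  rewrite (_ : phi b * j sb * (phi c * j sc) = phi (b * c) * j sb * j sc); last first.
    by rewrite rmorphM; ring.
  by rewrite ed e; ring.
case/pP.
  case/pP=> [pb'|pc']; first by left; apply: (dvd_a b sb pb).
  by right; apply: (dvd_a c sc pc).
move=> dv; exfalso; move: dv; apply: dvdV; first by rewrite !mulf_neq0.
rewrite !rmorphM !invfM -e1 invfM; apply: in_locM; first exact: in_locM.
by apply: in_locM => //; apply: in_loc_prodT.
Qed.

(** After removal of the factors from [T], the element is a unit [w] of the localization times
    primes of [P]. Induction on the list of these primes turns each into a unit or into a prime of
    [R/I]. *)
Theorem nagata a : ~ I a -> exists u (s : seq R),
  [/\ unitQ I u, forall x, x \in s -> primeQ I x & phi a = phi (u * \prod_(x <- s) x)].
Proof.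
suff aux ps b w : {in ps, forall p, rprime p} -> coprimeT b -> ~ I b -> in_loc w ->
    in_loc w^-1 -> phi b = w * j (\prod_(p <- ps) p) -> exists u (s : seq R),
  [/\ unitQ I u, forall x, x \in s -> primeQ I x & phi b = phi (u * \prod_(x <- s) x)].
  move=> /stripT[s [b [sT e bT b0]]].
  have [s1 [s10 ls1 [p1 e1]]] := denP b.
  have jn0 y : y != 0 -> j y != 0 by apply: contraNneq => /j0 ->.
  have phib0 := phi_neq0 kerI b0.
  have p10 : p1 != 0.
    by apply: contraTneq (mulf_neq0 phib0 (jn0 _ s10)) => p10; rewrite e1 p10 rmorph0 eqxx.
  have [u [ps [uu psp ep]]] := facP p10.
  have [|||u' [s' [uu' s'p eb]]] := @aux ps b (j u / j s1) psp bT b0.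
  - exact: in_locM.
  - rewrite invf_div; apply: in_locM => //; rewrite -(rmorphV j uu); exact: locP.
  - apply: (mulIf (jn0 _ s10)); rewrite e1 ep rmorphM; field.
    exact: jn0.
  exists u', (s ++ s'); split=> // [x|].
    by rewrite mem_cat => /orP[/sT/primeT|/s'p].
  by rewrite e eb big_cat !rmorphM mulrCA.
elim: ps b w => [|p ps IH] b w psp bT b0 lw lwV.
  rewrite big_nil rmorph1 mulr1 => bw; exists b, [::]; split=> //; last by rewrite big_nil mulr1.
  have [d ed] : exists d, phi d = w^-1.
    apply: (@coprimeT_quot 1 b) => //; rewrite bw divff ?rmorph1 // -bw.
    exact: (phi_neq0 kerI).
  by apply/(unitQE kerI); exists d; rewrite ed bw divff // -bw (phi_neq0 kerI).
have [p0 _ _] := psp p (mem_head _ _).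
have jp0 : j p != 0 by apply: contraNneq p0 => /j0 ->.
have psp' : {in ps, forall p, rprime p} by move=> p' h; apply: psp; rewrite inE h orbT.
(* A prime that becomes invertible in the localization is absorbed into [w]. *)
rewrite big_cons rmorphM => e; have [lp|lp] := classic (in_loc (j p)^-1).
  apply: (IH b (w * j p)) => //; last by rewrite e mulrA.
    exact: in_locM.
  by rewrite invfM; apply: in_locM.
(* Otherwise a numerator of [p], stripped of its factors in [T], is a prime [c1] of [R/I] associate
   to [p] in the localization. *)
have [s [c [sT ec]]] := locP p.
have c0 : ~ I c.
  by move/kerI/eqP; rewrite -ec mulf_eq0 (negPf jp0) (negPf (phi_prodT_neq0 sT)).
have [s' [c1 [s'T ec1 c1T c10]]] := stripT c0.
set t := \prod_(t <- s) t in ec; set t' := \prod_(t <- s') t in ec1.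
have t0 : phi t != 0 := phi_prodT_neq0 sT; have t'0 : phi t' != 0 := phi_prodT_neq0 s'T.
have e1 : phi c1 = j p * (phi t / phi t').
  by apply: (mulfI t'0); rewrite -ec1 -ec; field.
have lt : in_loc (phi t / phi t').
  by apply: in_locM; [apply: in_loc_phi|apply: in_loc_prodT].
have ltV : in_loc (phi t / phi t')^-1.
  by rewrite invf_div; apply: in_locM; [apply: in_loc_phi|apply: in_loc_prodT].
have pc1 := prime_in_loc (psp p (mem_head _ _)) lp c1T c10 lt ltV e1.
have [||d ed] := @coprimeT_quot b c1 (w * (phi t / phi t')^-1 * j (\prod_(i <- ps) i)) c1T c10.
- by do 2![apply: in_locM => //].
- by rewrite e e1; field; rewrite t0 t'0.
have ebd : phi b = phi c1 * phi d by rewrite ed e e1; field; rewrite t0 t'0.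
have [|||||u [s2 [uu s2p ed2]]] := IH d (w * (phi t / phi t')^-1) psp'.
- by move=> x xT /dvdE[y dy]; apply: (bT x xT); apply/dvdE; exists (c1 * y);
    rewrite ebd dy rmorphM mulrCA.
- by move/kerI=> d0; apply: b0; apply/kerI; rewrite ebd d0 mulr0.
- exact: in_locM.
- by rewrite invfM invrK; apply: in_locM.
- exact: ed.
exists u, (c1 :: s2); split=> // [x|]; first by rewrite inE => /orP[/eqP->|/s2p].
by rewrite ebd ed2 big_cons !rmorphM mulrCA.
Qed.

End Nagata.

(** * Krull dimension *)

Lemma msupp_sum_monomials (k : fieldType) n (I : eqType) (s : seq I) (P : pred I)
  (c : I -> k) (F : I -> 'X_{1..n}) b :
  b \in msupp (\sum_(a <- s | P a) c a *: 'X_[F a]) ->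
  exists a, [/\ a \in s, P a & b = F a].
Proof.
move/msupp_sum_le/flattenP=> [_ /mapP[a + ->] /msuppZ_le].
by rewrite mem_filter msuppX inE => /andP[Pa sa] /eqP ->; exists a.
Qed.

Section ChainIndependence.
Variables (k : fieldType) (n d : nat) (I : {mpoly k[n]} -> Prop).
Variables (P : nat -> {mpoly k[n]} -> Prop) (g : 'I_d -> {mpoly k[n]}).
Hypothesis chainP : prime_chainQ I d P.
Hypothesis gP : forall i : 'I_d, P i.+1 (g i) /\ ~ P i (g i).

Local Notation ev := (mmap (@mpolyC n k) g).

(** Descending induction on [j], then on degree. Write [H = H0 + 'X_j * H1]. Since [g j] lies in
    [P j.+1], so does [ev H0], and [H0 = 0]. Then [g j * ev H1] lies in [P j] while [g j] does not,
    so primality passes to [H1], of smaller degree. *)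
Lemma chain_indep_from (j : nat) H : (j <= d)%N ->
  (forall a, a \in msupp H -> forall i : 'I_d, (i < j)%N -> a i = 0%N) ->
  P j (ev H) -> H = 0.
Proof.
have [e] := ubnP (d - j); elim: e j H => // e IHe j H le_e jd Hj PH.
have [m Hm] : exists m, forall a, a \in msupp H -> (mdeg a < m)%N.
  by exists (msize H) => a; apply: msize_mdeg_lt.
have [[P0 [PD [PM [P1 PP]]]] _] := chainP.1 j jd.
elim: m H Hm Hj PH => [|m IHm] H Hm Hj PH.
  by apply/eqP; rewrite -msupp_eq0; case: msupp Hm => // a s /(_ a (mem_head _ _)).
have [ej|lt_j] := eqVneq j d.
  have eH : H = (H@_0)%:MP.
    apply/mpolyP=> a; rewrite mcoeffC; have [->|a0] := eqVneq a 0%MM; first by rewrite mulr1.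
    rewrite mulr0; apply/eqP; rewrite mcoeff_eq0; apply: contra a0 => /Hj h.
    by apply/eqP/mnmP=> i; rewrite mnm0E h // ej.
  apply: NNPP => H0; apply: P1; move: PH; rewrite {1}eH mmapC => /(PM (H@_0)^-1%:MP).
  rewrite -mpolyCM mulVf ?mpolyC1 //; apply/eqP=> h0; apply: H0.
  by rewrite eH h0 mpolyC0.
have {lt_j}lt_j : (j < d)%N by rewrite ltn_neqAle lt_j.
pose i0 := Ordinal lt_j; have [gS gN] := gP i0.
pose H0 := \sum_(a <- msupp H | a i0 == 0%N) H@_a *: 'X_[a].
pose H1 := \sum_(a <- msupp H | a i0 != 0%N) H@_a *: 'X_[a - U_(i0)].
have HE : H = H0 + 'X_i0 * H1.
  rewrite {1}[H]mpolyE (bigID (fun a : 'X_{1..d} => a i0 == 0%N)) /=; congr (_ + _).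
  rewrite mulr_sumr; apply: eq_bigr => a a0.
  by rewrite -scalerAr -mpolyXD addmC submK // lep1mP.
have evE : ev H = ev H0 + g i0 * ev H1.
  by rewrite {1}HE rmorphD rmorphM /= mmapX mmap1U.
have [[P0' [PD' [PM' [P1' PP']]]] _] := chainP.1 j.+1 lt_j.
have H00 : H0 = 0.
  apply: (IHe j.+1) => //; first by have := lt_j; move: le_e; clear; lia.
    move=> a /msupp_sum_monomials[b [bH /eqP b0 ->]] i.
    rewrite ltnS leq_eqVlt => /orP[/eqP ij|/(Hj _ bH)//].
    by rewrite (_ : i = i0) //; apply: val_inj.
  rewrite (_ : ev H0 = ev H + (- ev H1) * g i0); last by rewrite evE; ring.
  by apply: PD'; [apply: (chainP.2 j lt_j).1|apply: PM'].
suff -> : H = 0 by [].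
suff H10 : H1 = 0 by rewrite HE H00 H10 mulr0 addr0.
move: PH; rewrite evE H00 raddf0 add0r => /PP[//|PH1].
apply: IHm => // a /msupp_sum_monomials[b [bH b0 ->]].
  have := Hm b bH; rewrite -{1}(submK (_ : U_(i0) <= b)%MM) ?lep1mP //.
  by rewrite mdegD mdeg1 addn1 ltnS.
by move=> i ij; rewrite mnmBE (Hj b).
Qed.

Lemma chain_indep H : P 0 (ev H) -> H = 0.
Proof. by apply: chain_indep_from. Qed.

End ChainIndependence.

Section Counting.
Variables (k : fieldType) (m : nat).
Local Notation tofrac := (@FracField.tofrac {mpoly k[m]}).
Local Notation L := {fraction {mpoly k[m]}}.

Definition degree_le K (p : {mpoly k[m]}) := forall a, a \in msupp p -> (mdeg a <= K)%N.

Lemma degree_leM K K' p p' : degree_le K p -> degree_le K' p' ->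
  degree_le (K + K') (p * p').
Proof.
move=> pK p'K' a /msuppM_le/allpairsP[[b b'] /= [/pK bK /p'K' b'K ->]].
by rewrite mdegD leq_add.
Qed.

Lemma degree_leX K p e : degree_le K p -> degree_le (e * K) (p ^+ e).
Proof.
move=> pK; elim: e => [|e IH]; last by rewrite exprS mulSn; apply: degree_leM.
by move=> a; rewrite expr0 msupp1 inE => /eqP ->; rewrite mdeg0.
Qed.

Lemma degree_le_prod (J : finType) K (F : J -> {mpoly k[m]}) :
  (forall i, degree_le K (F i)) -> degree_le (#|J| * K) (\prod_i F i).
Proof.
move=> FK; rewrite -sum_nat_const; elim/big_rec2: _ => [|i p K' _ pK'].
  by move=> a; rewrite msupp1 inE => /eqP ->; rewrite mdeg0.
by rewrite addnC mulrC; apply: degree_leM.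
Qed.

End Counting.

Lemma fraction_repr (R : idomainType) (x : {fraction R}) :
  exists p d, d != 0 /\ x = FracField.tofrac p / FracField.tofrac d.
Proof.
elim/quotW: x => -[[p d] /= d0]; exists p, d; split=> //.
apply: (canRL (mulfK _)); first by rewrite tofrac_eq0.
unlock FracField.tofrac; rewrite -[LHS]FracField.pi_mul; apply/eqmodP.
by rewrite /= FracField.equivfE /FracField.mulf /= !numden_Ratio ?oner_neq0 ?mulr1 ?mul1r // mulrC.
Qed.

Lemma fraction_common_den (R : idomainType) (I : finType) (h : I -> {fraction R}) :
  exists (p : I -> R) d, d != 0 /\
    forall i, h i = FracField.tofrac (p i) / FracField.tofrac d.
Proof.
have /fin_all_exists[pd hpd] : forall i, exists pd : R * R, pd.2 != 0 /\
    h i = FracField.tofrac pd.1 / FracField.tofrac pd.2.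
  by move=> i; have [p [d pd]] := fraction_repr (h i); exists (p, d).
pose d i := (pd i).2; have d0 i : d i != 0 by case: (hpd i).
exists (fun i => (pd i).1 * \prod_(j | j != i) d j), (\prod_i d i); split.
  by apply/prodf_neq0 => i _.
move=> i; have [_ ->] := hpd i; have -> : \prod_i d i = d i * \prod_(j | j != i) d j.
  by rewrite (bigD1 i).
rewrite !rmorphM /= -mulf_div [X in _ = _ * X]divff ?mulr1 //.
by rewrite tofrac_eq0; apply/prodf_neq0 => j _.
Qed.

Section AlgebraicDependence.
Variables (k : fieldType) (m d : nat).
Hypothesis lt_md : (m < d)%N.
Local Notation tofrac := (@FracField.tofrac {mpoly k[m]}).

(* There are s ^ d monomials of exponents < s in h, while after clearing
   denominators they lie in a space of dimension at most (c s) ^ m. *)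
Lemma fraction_mpoly_dependent (h : 'I_d -> {fraction {mpoly k[m]}}) :
  exists H : {mpoly k[d]}, H != 0 /\ mmap (tofrac \o @mpolyC m k) h H = 0.
Proof.
have [p [Q [Q0 hp]]] := fraction_common_den h.
pose D := (msize Q + \sum_i msize (p i))%N.
have pD i : degree_le D (p i).
  move=> a /msize_mdeg_lt/ltnW/leq_trans; apply.
  by rewrite /D (bigD1 i) //= addnCA leq_addr.
have QD : degree_le D Q.
  by move=> a /msize_mdeg_lt/ltnW/leq_trans; apply; rewrite leq_addr.
(* Chosen so that [(K + 1)^m <= (d D + 1)^m s^m < s^(m + 1) <= s^d]: there are more monomials in [h]
   than coefficients to annihilate. *)
pose s := ((d * D).+1 ^ m).+1.
pose K := (d * (s * D))%N.
pose A := {ffun 'I_d -> 'I_s}; pose B := {ffun 'I_m -> 'I_K.+1}.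
have lt_BA : (#|B| < #|A|)%N.
  rewrite !card_ffun !card_ord.
  have le_K : (K.+1 <= (d * D).+1 * s)%N.
    rewrite /K mulnCA [(_ * s)%N]mulnC mulnSr -addn1 leq_add2l //.
  apply: (@leq_ltn_trans (((d * D).+1 * s) ^ m)).
    by case: (m) => // m'; rewrite leq_exp2r.
  rewrite expnMn; apply: (@leq_trans (s ^ m.+1)); last by rewrite leq_pexp2l.
  by rewrite expnS ltn_pmul2r // expn_gt0.
pose monA (a : A) : 'X_{1..d} := [multinom val (a i) | i < d].
pose monB (b : B) : 'X_{1..m} := [multinom val (b i) | i < m].
(* [F a] is the monomial [h^a] times [Q^(d s)], a factor independent of [a]. *)
pose F (a : A) := \prod_i (p i ^+ a i * Q ^+ (s - a i)).
have FK a : degree_le K (F a).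
  rewrite /K -{1}(card_ord d); apply: degree_le_prod => i.
  rewrite -{1}(subnKC (ltnW (ltn_ord (a i)))) mulnDl.
  by apply: degree_leM; apply: degree_leX.
pose M := \matrix_(i < #|A|, j < #|B|) (F (enum_val i))@_(monB (enum_val j)).
pose v := nz_row (kermx M).
have v0 : v != 0.
  rewrite nz_row_eq0 -mxrank_eq0 mxrank_ker subn_eq0 -ltnNge.
  exact: leq_ltn_trans (rank_leq_col M) lt_BA.
have vM : v *m M = 0 by apply/sub_kermxP/nz_row_sub.
pose c a := v 0 (enum_rank a).
have cF : \sum_a c a *: F a = 0.
  apply/mpolyP=> b; rewrite mcoeff0 raddf_sum /=.
  under eq_bigr => a _ do rewrite mcoeffZ.
  have [bK|Kb] := leqP (mdeg b) K; last first.
    rewrite big1 // => a _; rewrite (memN_msupp_eq0 (p := F a)) ?mulr0 //.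
    by apply: contraL Kb => /FK; rewrite -leqNgt.
  have lt_b i : (b i < K.+1)%N.
    by rewrite ltnS (leq_trans _ bK) // mdegE (bigD1 i) //= leq_addr.
  pose be : B := [ffun i => Ordinal (lt_b i)].
  have eb : b = monB be by apply/mnmP=> i; rewrite mnmE ffunE.
  have /matrixP/(_ 0 (enum_rank be)) := vM; rewrite !mxE => e; rewrite -[RHS]e.
  rewrite [RHS](reindex (@enum_rank A)) /=; last exact: onW_bij (@enum_rank_bij A).
  by apply: eq_bigr => a _; rewrite mxE !enum_rankK -eb.
have monA_inj : injective monA.
  move=> a a' /mnmP e; apply/ffunP=> i; apply/val_inj.
  by have := e i; rewrite !mnmE.
exists (\sum_a c a *: 'X_[monA a]); split.
  apply: contraNneq v0 => H0; apply/eqP/rowP=> i; rewrite mxE.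
  have /mpolyP/(_ (monA (enum_val i))) := H0; rewrite raddf_sum mcoeff0 /=.
  rewrite (bigD1 (enum_val i)) //= mcoeffZ mcoeffX eqxx mulr1 /c enum_valK.
  rewrite big1 ?addr0 // => a ai.
  by rewrite mcoeffZ mcoeffX (inj_eq monA_inj) (negPf ai) mulr0.
have Qn0 : tofrac Q ^+ (d * s) != 0 by rewrite expf_neq0 // tofrac_eq0.
apply: (mulfI Qn0); rewrite mulr0 -[RHS](rmorph0 tofrac) -cF !rmorph_sum mulr_sumr.
apply: eq_bigr => a _; rewrite /= mmapZ mmapX -mul_mpolyC rmorphM /= mulrCA; congr (_ * _).
rewrite /mmap1 /F rmorph_prod /= mulnC exprM -[d in X in X * _]card_ord -prodr_const.
rewrite -big_split; apply: eq_bigr => i _ /=; rewrite mnmE hp rmorphM !rmorphXn /=.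
rewrite expr_div_n mulrCA; congr (_ * _).
by rewrite (expfB (tofrac Q) (ltn_ord (a i))).
Qed.

End AlgebraicDependence.

(** Witnesses of the strict inclusions are algebraically independent modulo the bottom prime, hence
    modulo [I]; but [m.+1] elements of a field of rational functions in [m] variables are
    dependent. *)
Lemma krull_upper_bound (k : fieldType) (n m : nat) (I : {mpoly k[n]} -> Prop)
  (phi : {rmorphism {mpoly k[n]} -> {fraction {mpoly k[m]}}}) :
  (forall c, phi c%:MP = FracField.tofrac c%:MP) -> (forall x, I x <-> phi x = 0) ->
  ~ exists P, prime_chainQ I m.+1 P.
Proof.
move=> phiC kerI [P chP].
have /fin_all_exists[g gP] : forall i : 'I_m.+1, exists g, P i.+1 g /\ ~ P i g.
  by move=> i; have [_] := chP.2 i (ltn_ord i).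
have [H [H0 phH]] := fraction_mpoly_dependent (ltnSn m) (phi \o g).
case/eqP: H0; apply: (chain_indep chP gP); apply: (chP.1 0%N isT).2.
apply/kerI; rewrite -phH /mmap rmorph_sum; apply: eq_bigr => a _.
rewrite rmorphM phiC; congr (_ * _); rewrite rmorph_prod.
by apply: eq_bigr => i _; rewrite rmorphXn.
Qed.

Lemma prime_ideal_ker (R : comNzRingType) (S : idomainType) (f : {rmorphism R -> S}) :
  prime_ideal (fun x => f x = 0).
Proof.
split; first exact: rmorph0.
split; first by move=> a b fa fb; rewrite rmorphD fa fb addr0.
split; first by move=> a b fb; rewrite rmorphM fb mulr0.
split; first by rewrite rmorph1; apply/eqP/oner_neq0.
by move=> a b /eqP; rewrite rmorphM mulf_eq0 => /orP[]/eqP; [left|right].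
Qed.

(** * Primes generated by variables, and a long chain of them *)

Section VariableIdeals.
Variables (k : fieldType) (n : nat).

(** The ideal generated by the variables in [V] is represented as the kernel of this endomorphism,
    so that its primality is immediate. *)
Definition kill_vars (V : {set 'I_n}) : {mpoly k[n]} -> {mpoly k[n]} :=
  mmap (@mpolyC n k) (fun v => if v \in V then 0 else 'X_v).

HB.instance Definition _ V := GRing.RMorphism.on (kill_vars V).

Lemma kill_varsX V v : kill_vars V 'X_v = if v \in V then 0 else 'X_v.
Proof. by rewrite /kill_vars mmapX mmap1U. Qed.

Lemma kill_varsC V c : kill_vars V c%:MP = c%:MP.
Proof. by rewrite /kill_vars mmapC. Qed.

Lemma kill_varsX_eq0 V v : (kill_vars V 'X_v == 0) = (v \in V).
Proof.
rewrite kill_varsX; case: ifP => _; first by rewrite eqxx.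
by rewrite -msize_poly_eq0 msizeX.
Qed.

Lemma kill_vars_subset (V V' : {set 'I_n}) f : V \subset V' ->
  kill_vars V f = 0 -> kill_vars V' f = 0.
Proof.
move=> /subsetP sV f0; rewrite -[RHS](rmorph0 (kill_vars V')) -f0; symmetry.
apply: (@mpoly_rmorph_eq _ _ _ (kill_vars V' \o kill_vars V) (kill_vars V')) => [c|v] /=.
  by rewrite !kill_varsC.
rewrite [in LHS]kill_varsX; case: ifP => [/sV vV'|_] //.
by rewrite rmorph0 kill_varsX vV'.
Qed.

(** Two steps lead from [I] through [P1] to the ideal of [V0]; then the [n - #|V0|] other variables
    are added one at a time. *)
Lemma krull_variable_chain (I P1 : {mpoly k[n]} -> Prop) (V0 : {set 'I_n}) :
  prime_ideal I -> prime_ideal P1 -> (forall x, I x -> P1 x) ->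
  (exists x, P1 x /\ ~ I x) -> (forall x, P1 x -> kill_vars V0 x = 0) ->
  (exists x, kill_vars V0 x = 0 /\ ~ P1 x) ->
  exists P, prime_chainQ I (n - #|V0|).+2 P.
Proof.
move=> pI pP1 IP1 nIP1 P1V nP1V; pose s := enum (~: V0).
have ss : size s = (n - #|V0|)%N by rewrite -cardE cardsCs setCK card_ord.
pose V i := V0 :|: [set v in take i s].
pose P i x := match i with
  | 0 => I x | 1 => P1 x | i.+2 => kill_vars (V i) x = 0 end.
have sP i x : P i x -> P i.+1 x.
  case: i => [|[|i]] /=; first exact: IP1.
    by move=> /P1V; apply: kill_vars_subset; apply: subsetUl.
  apply: kill_vars_subset; apply: setUS; apply/subsetP=> v; rewrite !inE.
  by rewrite -(take_takel s (leqnSn i)) => /mem_take.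
exists P; split=> i; last first.
  move=> lt_i; split; first exact: sP.
  case: i lt_i => [|[|i]] lt_i //=.
    by rewrite (_ : V 0%N = V0) // /V take0; apply/setP=> v; rewrite !inE orbF.
  have lt_is : (i < size s)%N by rewrite ss.
  pose v0 : 'I_n := tnth (in_tuple s) (Ordinal lt_is).
  have sv : v0 = nth v0 s i by rewrite [LHS](tnth_nth v0).
  have vs : v0 \in s by rewrite sv mem_nth.
  have iv : index v0 s = i by rewrite sv index_uniq // enum_uniq.
  exists 'X_v0; split; first by apply/eqP; rewrite kill_varsX_eq0 !inE in_take // iv ltnSn orbT.
  apply/eqP; rewrite kill_varsX_eq0 !inE in_take // iv ltnn orbF.
  by move: vs; rewrite mem_enum inE.
move=> _; split.
  by case: i => [|[|i]] //; apply: prime_ideal_ker.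
by move=> x Ix; elim: i => [|i IH] //; apply: sP.
Qed.

End VariableIdeals.

(** * Trinomial rings *)

Section GenIdeal.
Variables (R : comNzRingType) (J : finType) (S : pred J) (f : J -> R).

Lemma gen_ideal0 : gen_ideal S f 0.
Proof. by exists (fun=> 0); rewrite big1 // => i _; rewrite mul0r. Qed.

Lemma gen_idealD a b : gen_ideal S f a -> gen_ideal S f b -> gen_ideal S f (a + b).
Proof.
move=> [g ->] [h ->]; exists (fun i => g i + h i).
by rewrite -big_split; apply: eq_bigr => i _; rewrite mulrDl.
Qed.

Lemma gen_idealM a b : gen_ideal S f b -> gen_ideal S f (a * b).
Proof.
move=> [g ->]; exists (fun i => a * g i).
by rewrite mulr_sumr; apply: eq_bigr => i _; rewrite mulrA.
Qed.

Lemma gen_ideal_gen i : S i -> gen_ideal S f (f i).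
Proof.
move=> Si; exists (fun i' => (i' == i)%:R); rewrite (bigD1 i) //= eqxx mul1r.
by rewrite big1 ?addr0 // => i' /andP[_ /negPf ->]; rewrite mul0r.
Qed.

Lemma gen_ideal_ker (S' : nzRingType) (phi : {rmorphism R -> S'}) x :
  (forall i, S i -> phi (f i) = 0) -> gen_ideal S f x -> phi x = 0.
Proof.
move=> f0 [g ->]; rewrite rmorph_sum big1 // => i Si.
by rewrite rmorphM f0 // mulr0.
Qed.

End GenIdeal.

Lemma prime_ideal_iff (R : comNzRingType) (P Q : R -> Prop) :
  (forall x, P x <-> Q x) -> prime_ideal P -> prime_ideal Q.
Proof.
move=> PQ [p0 [pD [pM [p1 pP]]]]; split; first exact/PQ.
split; first by move=> a b /PQ Pa /PQ Pb; apply/PQ/pD.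
split; first by move=> a b /PQ Pb; apply/PQ/pM.
split; first by move/PQ.
by move=> a b /PQ/pP[]/PQ; [left|right].
Qed.

Lemma primeQ_of_ker (R : comNzRingType) (L : idomainType) (I : R -> Prop) p
  (f : {rmorphism R -> L}) : (forall a, dvdQ I p a <-> f a = 0) ->
  (forall a b, I b -> I (a * b)) -> ~ I p -> primeQ I p.
Proof.
move=> df IM Ip; split=> //; split.
  move=> [v uv]; have /df/eqP : dvdQ I p 1.
    by exists v; rewrite -opprB -mulN1r; apply: IM.
  by rewrite rmorph1 oner_eq0.
by move=> a b /df/eqP; rewrite rmorphM mulf_eq0 => /orP[]/eqP/df; [left|right].
Qed.

Lemma bmat_complement r n q (bl : 'I_n -> 'I_r.+1) be i1 (N : 'M[int]_(n, r)) :
  n = (r + q)%N -> bmat bl be i1 *m N = 1%:M ->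
  exists (E : 'M[int]_(n, q)) (E' : 'M[int]_(q, n)),
  [/\ bmat bl be i1 *m E = 0, E' *m E = 1%:M & forall a : 'rV[int]_n,
      a *m E = 0 -> exists c, a = c *m bmat bl be i1].
Proof.
move=> nE MN; have [q' [E [E' [nE' ME EE kE]]]] := int_split_complement MN.
have eq' : q' = q by apply: (@addnI r); rewrite -nE'.
by subst q'; exists E, E'.
Qed.

Section Trinomial.
Variables (k : fieldType) (r n q : nat).
Variables (bl : 'I_n -> 'I_r.+1) (be : 'I_n -> nat) (lambda : 'I_r.+1 -> k).
Variables (pt : 'I_r.+1 -> 'I_n) (bz : 'I_n -> int) (d : 'I_r.+1 -> nat).
Hypotheses (nE : n = (r + q)%N) (hr : (2 <= r)%N).
Hypotheses (bl_pt : forall l, bl (pt l) = l) (be_gt0 : forall v, (0 < be v)%N).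
Hypothesis cop_d : forall i j, i != j -> coprime (d i) (d j).
Hypothesis bezout_d : forall l,
  \sum_(v | bl v == l) bz v * (be v)%:Z = (d l)%:Z.
Hypothesis lambda_neq0 : forall i : 'I_r.+1, (2 <= i)%N -> lambda i != 0.
Hypothesis lambda_inj : forall i i' : 'I_r.+1, (2 <= i)%N -> (2 <= i')%N ->
  i != i' -> lambda i != lambda i'.

Local Notation R := {mpoly k[n]}.
Local Notation L := {fraction {mpoly k[q.+1]}}.
Local Notation tofrac := (@FracField.tofrac {mpoly k[q.+1]}).
Local Notation constL := (tofrac \o @mpolyC q.+1 k).
Local Notation bm := (bmon bl be).
Local Notation i1 := (inord 1 : 'I_r.+1).
Local Notation T l := ('X_[bm l] : R).

Definition trinomial_ideal := gen_ideal (fun i : 'I_r.+1 => (2 <= i)%N)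
  (fun i => T ord0 + lambda i *: T i1 + T i).
Local Notation I := trinomial_ideal.

Lemma val_i1 : i1 = 1%N :> nat.
Proof. by rewrite inordK // ltnS ltnW. Qed.

Lemma i1_neq0 : (i1 == ord0) = false.
Proof. by rewrite -val_eqE /= val_i1. Qed.

Lemma ord0_neq_i1 : (ord0 == i1) = false.
Proof. by rewrite eq_sym i1_neq0. Qed.

Variant block_index_spec (l : 'I_r.+1) : Prop :=
  | BlockIndex0 of l = ord0 | BlockIndex1 of l = i1 | BlockIndex2 of (2 <= l)%N.

Lemma block_indexP l : block_index_spec l.
Proof.
case: l => [[|[|l]] hl]; [apply: BlockIndex0|apply: BlockIndex1|exact: BlockIndex2].
  exact: val_inj.
by apply: val_inj; rewrite /= val_i1.
Qed.

(* In the quotient, T_l = lin T_0 T_1 l. *)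
Definition lin (A : lmodType k) (x y : A) (l : 'I_r.+1) : A :=
  if l == ord0 then x else if l == i1 then y else - (x + lambda l *: y).

Lemma lin0 (A : lmodType k) (x y : A) : lin x y ord0 = x.
Proof. by rewrite /lin eqxx. Qed.

Lemma lin1 (A : lmodType k) (x y : A) : lin x y i1 = y.
Proof. by rewrite /lin i1_neq0 eqxx. Qed.

Lemma lin2 (A : lmodType k) (x y : A) (l : 'I_r.+1) : (2 <= l)%N ->
  lin x y l = - (x + lambda l *: y).
Proof.
move=> l2; rewrite /lin -!val_eqE /= val_i1.
by case: eqP l2 => [->//|_]; case: eqP => [->|].
Qed.

(** The values of the linear forms at the point [(x : y)] of the projective line, with [k] regarded
    as a module over itself. *)
Definition lin_at (x y : k) (l : 'I_r.+1) : k := lin (x : k^o) (y : k^o) l.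

Lemma lin_at0 x y : lin_at x y ord0 = x.
Proof. exact: (lin0 (x : k^o) y). Qed.

Lemma lin_at1 x y : lin_at x y i1 = y.
Proof. exact: (lin1 (x : k^o) y). Qed.

Lemma lin_at2 x y (l : 'I_r.+1) : (2 <= l)%N -> lin_at x y l = - (x + lambda l * y).
Proof. exact: (@lin2 k^o). Qed.

Lemma lin_at_relation (F : fieldType) (c : {rmorphism k -> F}) x y Y (l : 'I_r.+1) :
  (2 <= l)%N -> c x * Y + c (lambda l) * (c y * Y) + c (lin_at x y l) * Y = 0.
Proof. by move=> l2; rewrite lin_at2 // rmorphN rmorphD rmorphM; ring. Qed.

Lemma trinomial_lin l : I (T l - lin (T ord0) (T i1) l).
Proof.
have [->|->|l2] := block_indexP l; rewrite ?lin0 ?lin1 ?subrr; try exact: gen_ideal0.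
by rewrite lin2 // opprK addrC; apply: (gen_ideal_gen (S := fun i : 'I_r.+1 => (2 <= i)%N) (fun i => T ord0 + lambda i *: T i1 + T i)).
Qed.

Lemma pt_hbl l : exists2 v, bl v = l & (0 < be v)%N.
Proof. by exists (pt l). Qed.

(** * Primes of the quotient obtained by specializing [z] to a point of the projective line *)

Section SpecialPrime.
Variables (p : R) (x0 y0 : k) (j1 : 'I_r.+1) (be' : 'I_n -> nat).
Variables (bz' : 'I_n -> int) (d' : 'I_r.+1 -> nat).
Local Notation g l := (lin_at x0 y0 l).
Local Notation bm' := (bmon bl be').
Hypothesis base : (y0 = 1 /\ j1 = i1) \/ [/\ x0 = 1, y0 = 0 & j1 = ord0].
Hypothesis cop_d' : forall i j, i != j -> coprime (d' i) (d' j).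
Hypothesis bezout_d' : forall l,
  \sum_(v | bl v == l) bz' v * (be' v)%:Z = (d' l)%:Z.
Hypothesis hbl' : forall l, exists2 v, bl v = l & (0 < be' v)%N.
Hypothesis be'E : forall l, g l != 0 -> bm' l = bm l.
Hypothesis p_line : dvdQ I p (y0 *: T ord0 - x0 *: T i1).
Hypothesis p_zero : forall l, g l = 0 -> dvdQ I p 'X_[bm' l].
Hypothesis kill1 : forall v, g (bl v) = 0 -> (0 < be' v)%N -> bm' (bl v) = U_(v)%MM.
Hypothesis pE : p = y0 *: T ord0 - x0 *: T i1 \/
  exists v, [/\ p = 'X_v, g (bl v) = 0 & (0 < be' v)%N].

(** Modulo [p] the ratio [T_0 : T_1] is frozen at [(x0 : y0)], so every [T_l] is the constant [g l]
    times the base block [j1], where [g j1 = 1]. The kernel of the resulting block point is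
    [I + (p)], which is thus prime. *)
Lemma special_prime : exists f : {rmorphism R -> L},
  (forall a, dvdQ I p a <-> f a = 0) /\
  (forall v, g (bl v) != 0 \/ be' v = 0%N -> f 'X_v != 0).
Proof.
pose G l : {poly k} := (g l)%:P.
have Gj1 : G j1 = 1.
  by rewrite /G; case: base => [[-> ->]|[-> _ ->]]; rewrite ?lin_at1 ?lin_at0.
have g_j1 : g j1 != 0.
  by case: base => [[-> ->]|[-> _ ->]]; rewrite ?lin_at1 ?lin_at0 oner_neq0.
have [N MN] := bmat_right_inverse j1 cop_d' bezout_d'.
have [E [E' [ME EE kerE]]] := bmat_complement nE MN.
pose h := block_point bl be' j1 G N E : 'I_n -> L.
have kill1' v : killed bl be' G v -> bm' (bl v) = U_(v)%MM.
  by rewrite /killed polyC_eq0 => /andP[/eqP]; apply: kill1.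
have hG l : mmap1 h (bm' l) = zeval q (G l) * mmap1 h (bm' j1).
  exact: (block_pointG hbl' MN ME Gj1 kill1').
exists (mmap constL h); split; last first.
  move=> v gv; rewrite /= mmapX mmap1U; apply: block_point_neq0.
  rewrite /killed polyC_eq0; case: gv => [/negPf-> //|->]; by rewrite andbF.
(* The point is built for [be'], but the relations concern [be]. The exponents agree where
   [g l != 0]; elsewhere [T_l] contains a killed variable and both sides are 0. *)
have [Y hT] : exists Y, forall l, mmap1 h (bm l) = constL (g l) * Y.
  exists (mmap1 h (bm j1)) => l; have [gl|gl] := eqVneq (g l) 0; last first.
    by rewrite -!be'E // hG /G zevalC.
  rewrite gl /= mpolyC0 rmorph0 mul0r.
  have [v vl bv] := hbl' l; rewrite /mmap1 (bigD1 v) //= mnmE vl eqxx.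
  by rewrite /h /block_point /killed vl polyC_eq0 gl eqxx bv /= expr0n gtn_eqF // mul0r.
have phi_lin : mmap constL h (y0 *: T ord0 - x0 *: T i1) = 0.
  rewrite rmorphB /= !mmapZ !mmapX !hT lin_at0 lin_at1.
  by rewrite mulrCA subrr.
have phiI a : I a -> mmap constL h a = 0.
  apply: (gen_ideal_ker (phi := mmap constL h)) => l l2.
  rewrite !rmorphD /= mmapZ !mmapX !hT lin_at0 lin_at1.
  exact: (lin_at_relation constL).
have phi_p : mmap constL h p = 0.
  case: pE => [->//|[v [-> gv bv]]].
  by rewrite mmapX mmap1U /h /block_point /killed polyC_eq0 gv eqxx bv.
have J0 : dvdQ I p 0 by exists 0; rewrite mulr0 subrr; apply: gen_ideal0.
have JD a b : dvdQ I p a -> dvdQ I p b -> dvdQ I p (a + b).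
  move=> [c ac] [c' bc']; exists (c + c').
  by rewrite mulrDr opprD addrACA; apply: gen_idealD.
have JM a b : dvdQ I p b -> dvdQ I p (a * b).
  by move=> [c bc]; exists (a * c); rewrite mulrCA -mulrBr; apply: gen_idealM.
have JZ c b : dvdQ I p b -> dvdQ I p (c *: b) by rewrite -mul_mpolyC; apply: JM.
have JI a : I a -> dvdQ I p a by move=> Ia; exists 0; rewrite mulr0 subr0.
move=> a; split=> [[c /phiI]|].
  by rewrite rmorphB rmorphM /= phi_p mul0r subr0.
(* The [G l] are constants, so [x] appears with coefficient 0 and the filler [x := 0] is chosen. *)
apply: (blocks_kernel hbl' (i1 := j1) (G := G) (x := 0) J0 JD JM) => [l|l||].
- by apply: leq_trans (size_polyC_leq1 _) _.
- rewrite scaler0 addr0 coefC eqxx.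
  have [gl|gl] := eqVneq (g l) 0; first by rewrite gl scale0r subr0; apply: p_zero.
  rewrite !be'E //.
  rewrite (_ : _ - _ = (T l - lin (T ord0) (T i1) l) +
     (lin (T ord0) (T i1) l - g l *: T j1)); last by rewrite addrA subrK.
  apply: JD; first exact/JI/trinomial_lin.
  (* The difference is a multiple of the line [y0 T_0 - x0 T_1], which [p] divides. *)
  case: base p_line => [[-> ->]|[-> -> ->]]; rewrite ?scale1r ?scale0r.
    move=> hp; have [->|->|l2] := block_indexP l.
    + by rewrite lin0 lin_at0.
    + by rewrite lin1 lin_at1 scale1r subrr.
    rewrite lin2 // lin_at2 // scaleNr scalerDl mulr1.
    rewrite (_ : _ - _ = (-1) *: (T ord0 - x0 *: T i1)); first exact: JZ.
    by rewrite scaleN1r opprK !opprD !opprK addrACA addNr addr0.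
  rewrite sub0r => hp; have [->|->|l2] := block_indexP l.
  + by rewrite lin0 lin_at0 scale1r subrr.
  + rewrite lin1 lin_at1 scale0r subr0 -[T i1]opprK -scaleN1r; exact: JZ.
  rewrite lin2 // lin_at2 // mulr0 addr0 scaleN1r opprK opprD addrAC addNr add0r -scalerN.
  exact: JZ.
- exact: hG.
- exact: (block_point_indep kerE Gj1 kill1').
Qed.

End SpecialPrime.

Definition zlin (l : 'I_r.+1) : {poly k} := lin ('X : {poly k}) 1 l.

Lemma zlin_size l : (size (zlin l) <= 2)%N.
Proof.
rewrite /zlin; have [->|->|l2] := block_indexP l.
- by rewrite lin0 size_polyX.
- by rewrite lin1 size_poly1.
by rewrite lin2 // size_polyN -mul_polyC mulr1 size_XaddC.
Qed.

Lemma zlin_neq0 l : zlin l != 0.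
Proof.
rewrite /zlin; have [->|->|l2] := block_indexP l.
- by rewrite lin0 polyX_eq0.
- by rewrite lin1 oner_neq0.
by rewrite lin2 // oppr_eq0 -mul_polyC mulr1 -size_poly_eq0 size_XaddC.
Qed.

Lemma zlin_killed v : killed bl be zlin v = false.
Proof. by rewrite /killed (negPf (zlin_neq0 _)). Qed.

(** * The embedding into [k(z, Y)] and the properties read off from it *)

Section Embedding.
Variables (N : 'M[int]_(n, r)) (E : 'M[int]_(n, q)) (E' : 'M[int]_(q, n)).
Hypotheses (MN : bmat bl be i1 *m N = 1%:M) (ME : bmat bl be i1 *m E = 0).
Hypothesis EE : E' *m E = 1%:M.
Hypothesis kerE : forall a : 'rV[int]_n, a *m E = 0 ->
  exists c, a = c *m bmat bl be i1.

Local Notation h := (block_point bl be i1 zlin N E : 'I_n -> L).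
Local Notation phi := (mmap constL h : {mpoly k[n]} -> L).

Lemma zlin1 : zlin i1 = 1. Proof. exact: lin1. Qed.

Lemma emb_kill v : killed bl be zlin v -> bm (bl v) = U_(v)%MM.
Proof. by rewrite zlin_killed. Qed.

Lemma emb_var_neq0 v : phi 'X_v != 0.
Proof. by rewrite mmapX mmap1U block_point_neq0 // zlin_killed. Qed.

Lemma emb_block l : phi (T l) = zeval q (zlin l) * phi (T i1).
Proof. by rewrite !mmapX; apply: (block_pointG pt_hbl MN ME zlin1 emb_kill). Qed.

Lemma emb_mnm_neq0 m : phi 'X_[m] != 0.
Proof.
rewrite mmapX; apply/prodf_neq0 => v _.
by rewrite expf_neq0 // block_point_neq0 // zlin_killed.
Qed.

Lemma zlin_relation (l : 'I_r.+1) : (2 <= l)%N ->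
  zlin ord0 + (lambda l)%:P + zlin l = 0.
Proof. by move=> l2; rewrite /zlin lin0 lin2 // alg_polyC subrr. Qed.

(** The generators vanish because [g_0 + lambda_l g_1 + g_l = 0]; the converse is [blocks_kernel]
    with [x = T_0]. That the quotient is a domain is read off from this. *)
Lemma trinomial_ker x : I x <-> phi x = 0.
Proof.
split.
  apply: (gen_ideal_ker (phi := mmap constL h)) => l l2.
  rewrite !rmorphD /= mmapZ emb_block (emb_block l) /=.
  have -> : tofrac (lambda l)%:MP = zeval q (lambda l)%:P by rewrite zevalC.
  by rewrite -!mulrDl -!rmorphD zlin_relation // rmorph0 mul0r.
apply: (blocks_kernel pt_hbl (i1 := i1) (G := zlin) (x := T ord0)).
- exact: gen_ideal0.
- exact: gen_idealD.
- exact: gen_idealM.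
- exact: zlin_size.
- move=> l; rewrite [X in _ - X](_ : _ = lin (T ord0) (T i1) l); first exact: trinomial_lin.
  rewrite /zlin; have [->|->|l2] := block_indexP l.
  + by rewrite !lin0 !coefX scale0r add0r scale1r.
  + by rewrite !lin1 !coef1 scale1r scale0r addr0.
  rewrite !lin2 // !coefN !coefD !coefZ !coefX !coef1 /= mulr0 mulr1 add0r addr0.
  by rewrite !scaleNr scale1r opprD addrC.
- exact: (block_pointG pt_hbl MN ME zlin1 emb_kill).
- exact: (block_point_indep kerE zlin1 emb_kill).
Qed.

Lemma trinomial_zrel x y : phi (x *: T ord0 + y *: T i1) =
  zeval q (x *: 'X + y%:P) * phi (T i1).
Proof.
rewrite rmorphD /= !mmapZ emb_block /zlin lin0 -mul_polyC rmorphD rmorphM /=.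
by rewrite !zevalC mulrDl mulrA.
Qed.

Lemma line_not_in x y : (x != 0) || (y != 0) -> ~ I (x *: T ord0 + y *: T i1).
Proof.
move=> xy /trinomial_ker/eqP; rewrite trinomial_zrel mulf_eq0 (negPf (emb_mnm_neq0 _)).
rewrite orbF zeval_eq0 => /eqP/polyP e.
have := e 1%N; have := e 0%N; rewrite !coefD !coefZ !coefX !coefC /=.
rewrite mulr0 mulr1 add0r addr0 => y0 x0.
by move: xy; rewrite x0 y0 eqxx.
Qed.

Lemma var_not_in v : ~ I 'X_v.
Proof. by move=> /trinomial_ker/eqP; rewrite (negPf (emb_var_neq0 v)). Qed.

(** At the point [(-mu : 1)] the linear forms take the values [-mu], [1] and [mu - lambda l], all
    nonzero: nothing is killed and the exponents stay as they are. *)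
Lemma line_prime mu : mu != 0 -> (forall i : 'I_r.+1, (2 <= i)%N -> mu != lambda i) ->
  primeQ I (T ord0 + mu *: T i1).
Proof.
move=> mu0 mul; set p := T ord0 + _.
have pE : p = 1 *: T ord0 - (- mu) *: T i1 by rewrite scale1r scaleNr opprK.
have Ip : ~ I p.
  by rewrite /p -[T ord0]scale1r; apply: line_not_in; rewrite oner_neq0.
have g0 l : lin_at (- mu) 1 l != 0.
  have [->|->|l2] := block_indexP l; rewrite ?lin_at0 ?lin_at1 ?oner_neq0 ?oppr_eq0 //.
  by rewrite lin_at2 // mulr1 oppr_eq0 addrC subr_eq0 eq_sym mul.
have [||||||f [df _]] := @special_prime p (- mu) 1 i1 be bz d _ cop_d bezout_d pt_hbl.
- by left.
- by [].
- by exists 1; rewrite pE mulr1 subrr; apply: gen_ideal0.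
- by move=> l gl; case/eqP: (g0 l).
- by move=> v gl; case/eqP: (g0 (bl v)).
- by left.
by apply: (primeQ_of_ker df _ Ip); apply: gen_idealM.
Qed.

(* The block of the chosen variable v0 is replaced by v0 alone, so that the
   other variables of this block become free. *)
Lemma var_special v0 : exists f : {rmorphism R -> L},
  (forall a, dvdQ I 'X_v0 a <-> f a = 0) /\
  (forall v, bl v != bl v0 -> f 'X_v != 0).
Proof.
pose be' v := if bl v == bl v0 then (v == v0 : nat) else be v.
pose bz' v := if bl v == bl v0 then 1 else bz v.
pose d' l := if l == bl v0 then 1%N else d l.
(* [(x0 : y0)] is the root of the linear form of the block of [v0]: [(0 : 1)], [(1 : 0)] or
   [(- lambda : 1)]. The base [j1] is a block whose form has value 1 there. *)
pose x0 : k := if bl v0 == ord0 then 0 else if bl v0 == i1 then 1 else - lambda (bl v0).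
pose y0 : k := if bl v0 == i1 then 0 else 1.
pose j1 := if bl v0 == i1 then ord0 else i1.
have dv : dvdQ I 'X_v0 'X_v0 by exists 1; rewrite mulr1 subrr; apply: gen_ideal0.
(* The [lambda l] being nonzero and distinct, the linear forms have pairwise distinct roots, so just
   one block is killed. *)
have g0 l : (lin_at x0 y0 l == 0) = (l == bl v0).
  rewrite /x0 /y0; have [e|e|e] := block_indexP (bl v0).
  - rewrite e eqxx ord0_neq_i1; have [->|->|l2] := block_indexP l.
    + by rewrite lin_at0 !eqxx.
    + by rewrite lin_at1 oner_eq0 i1_neq0.
    rewrite lin_at2 // mulr1 add0r oppr_eq0 (negPf (lambda_neq0 l2)).
    by rewrite -val_eqE /=; case: eqP l2 => // ->.
  - rewrite e eqxx i1_neq0; have [->|->|l2] := block_indexP l.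
    + by rewrite lin_at0 oner_eq0 ord0_neq_i1.
    + by rewrite lin_at1 !eqxx.
    rewrite lin_at2 // mulr0 addr0 oppr_eq0 oner_eq0 -val_eqE /= val_i1.
    by case: eqP l2 => // ->.
  have e0 : (bl v0 == ord0) = false by rewrite -val_eqE /=; case: eqP e => // ->.
  have e1 : (bl v0 == i1) = false by rewrite -val_eqE /= val_i1; case: eqP e => // ->.
  rewrite e0 e1; have [->|->|l2] := block_indexP l.
  + by rewrite lin_at0 oppr_eq0 (negPf (lambda_neq0 e)) eq_sym e0.
  + by rewrite lin_at1 oner_eq0 eq_sym e1.
  rewrite lin_at2 // mulr1 oppr_eq0 addrC subr_eq0.
  have [->|ll] := eqVneq l (bl v0); first by rewrite eqxx.
  by rewrite (negPf (lambda_inj l2 e ll)).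
have bmv : bmon bl be' (bl v0) = U_(v0)%MM.
  apply/mnmP=> v; rewrite mnmE mnm1E /be' eq_sym.
  by have [->|nv] := eqVneq v v0; [rewrite eqxx|case: ifP => // ->].
have dT : dvdQ I 'X_v0 (T (bl v0)).
  exists 'X_[bm (bl v0) - U_(v0)]; rewrite -mpolyXD addmC submK ?subrr; first exact: gen_ideal0.
  by rewrite lep1mP mnmE eqxx -lt0n.
have dD a b : dvdQ I 'X_v0 a -> dvdQ I 'X_v0 b -> dvdQ I 'X_v0 (a + b).
  move=> [c ac] [c' bc']; exists (c + c').
  by rewrite mulrDr opprD addrACA; apply: gen_idealD.
have dN a : dvdQ I 'X_v0 a -> dvdQ I 'X_v0 (- a).
  move=> [c ac]; exists (- c).
  rewrite (_ : _ - _ = (-1) * (a - 'X_v0 * c)); last by ring.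
  exact: gen_idealM.
have dI a : I a -> dvdQ I 'X_v0 a by move=> Ia; exists 0; rewrite mulr0 subr0.
have dlin : dvdQ I 'X_v0 (lin (T ord0) (T i1) (bl v0)).
  rewrite -[lin _ _ _](subrK (T (bl v0))); apply: dD => //; apply: dI.
  by rewrite -opprB -mulN1r; apply/gen_idealM/trinomial_lin.
have [|||||||||f [df fX]] := @special_prime 'X_v0 x0 y0 j1 be' bz' d'.
- rewrite /y0 /j1 /x0; case: (eqVneq (bl v0) i1) => [->|_]; last by left.
  by right; rewrite i1_neq0.
- move=> i j ij; rewrite /d'; case: ifP => _; first by rewrite coprime1n.
  by case: ifP => _; rewrite ?coprimen1 // cop_d.
- move=> l; rewrite /d' /bz' /be'; have [->|ll] := eqVneq l (bl v0).
    rewrite (bigD1 v0) //= !eqxx big1 ?addr0 // => v /andP[-> /negPf ->].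
    by rewrite mulr0.
  rewrite -bezout_d; apply: eq_bigr => v /eqP vl.
  by rewrite vl (negPf ll).
- move=> l; have [->|ll] := eqVneq l (bl v0); first by exists v0; rewrite // /be' !eqxx.
  by exists (pt l); rewrite // /be' bl_pt (negPf ll).
- move=> l; rewrite g0 => ll; apply/mnmP=> v; rewrite !mnmE /be'.
  by case: eqP => // ->; rewrite (negPf ll).
- move: dlin; rewrite /x0 /y0; have [->|->|e] := block_indexP (bl v0).
  + by rewrite lin0 ord0_neq_i1 eqxx scale1r scale0r subr0.
  + rewrite lin1 eqxx i1_neq0 scale1r scale0r sub0r; exact: dN.
  have e0 : (bl v0 == ord0) = false by rewrite -val_eqE /=; case: eqP e => // ->.
  have e1 : (bl v0 == i1) = false by rewrite -val_eqE /= val_i1; case: eqP e => // ->.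
  rewrite e0 e1 lin2 // scale1r scaleNr opprK => /dN; rewrite opprK //.
- by move=> l /eqP; rewrite g0 => /eqP ->; rewrite bmv.
- move=> v /eqP; rewrite g0 => /eqP vl; rewrite vl bmv /be' vl eqxx.
  by case: (eqVneq v v0) => [->|].
- right; exists v0; split=> //; first by apply/eqP; rewrite g0.
  by rewrite /be' !eqxx.
exists f; split=> // v vl; apply: fX; left.
by rewrite g0.
Qed.

Lemma var_prime v : primeQ I 'X_v.
Proof.
have [f [df _]] := var_special v.
apply: (primeQ_of_ker df); [exact: gen_idealM|exact: var_not_in].
Qed.

(** * Localization at the variables and the hypotheses of Nagata's criterion *)

Definition vars : seq R := [seq 'X_v | v : 'I_n].
Local Notation phiR := (phi : {rmorphism R -> L}).
Local Notation loc := (in_loc phiR vars).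

Lemma vars_prime t : t \in vars -> primeQ I t.
Proof. by move=> /mapP[v _ ->]; apply: var_prime. Qed.

Lemma locD x y : loc x -> loc y -> loc (x + y).
Proof.
move=> [s [c [sT e]]] [s' [c' [s'T e']]].
exists (s ++ s'), (c * \prod_(t <- s') t + c' * \prod_(t <- s) t).
split=> [t|]; first by rewrite mem_cat => /orP[/sT|/s'T].
by rewrite big_cat rmorphD !rmorphM -e -e'; ring.
Qed.

Definition loc_unit x := loc x /\ loc x^-1.

Lemma loc_unitM x y : loc_unit x -> loc_unit y -> loc_unit (x * y).
Proof. by move=> [lx lx'] [ly ly']; split; rewrite ?invfM; apply: in_locM. Qed.

Lemma loc_unit1 : loc_unit 1.
Proof. by split; rewrite ?invr1 -(rmorph1 phiR); apply: in_loc_phi. Qed.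

Lemma loc_unitV x : loc_unit x -> loc_unit x^-1.
Proof. by move=> [lx lx']; split; rewrite ?invrK. Qed.

Lemma loc_unit_exprz x (e : int) : loc_unit x -> loc_unit (x ^ e).
Proof.
move=> lx; have lX m : loc_unit (x ^+ m).
  by elim: m => [|m IH]; [exact: loc_unit1|rewrite exprS; apply: loc_unitM].
by case: e => m; [exact: lX|apply/loc_unitV/lX].
Qed.

Lemma loc_unit_prod (J : finType) (F : J -> L) :
  (forall i, loc_unit (F i)) -> loc_unit (\prod_i F i).
Proof. by move=> h; elim/big_ind: _ => //; [exact: loc_unit1|exact: loc_unitM]. Qed.

Lemma loc_unit_var v : loc_unit (h v).
Proof.
have -> : h v = phi (\prod_(t <- [:: 'X_v]) t) by rewrite big_seq1 mmapX mmap1U.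
split; first exact: (in_loc_phi phiR).
apply: (in_loc_prodT trinomial_ker vars_prime) => t.
by rewrite inE => /eqP ->; apply: map_f; rewrite mem_enum.
Qed.

Lemma loc_unit_mnm m : loc_unit (phi 'X_[m]).
Proof.
rewrite mmapX; apply: loc_unit_prod => v.
by rewrite exprnP; apply/loc_unit_exprz/loc_unit_var.
Qed.

Lemma zeval_zlin l : zeval q (zlin l) = phi (T l) / phi (T i1).
Proof. by rewrite emb_block mulfK // emb_mnm_neq0. Qed.

Lemma loc_unit_zlin l : loc_unit (zeval q (zlin l)).
Proof. by rewrite zeval_zlin; apply/loc_unitM/loc_unitV; apply: loc_unit_mnm. Qed.

Lemma active_zlin l : active_poly zlin l = zlin l.
Proof. by rewrite /active_poly (negPf (zlin_neq0 l)). Qed.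

Lemma emb_varE v : h v = toric N E (fun l => active_poly zlin (lift i1 l)) v.
Proof. by rewrite /block_point zlin_killed. Qed.

Lemma loc_unit_yvar (j : 'I_q) : loc_unit (yvar k j).
Proof.
rewrite (yvar_toric N EE (fun l => active_poly_neq0 zlin (lift i1 l))).
apply: loc_unitM; apply: loc_unit_prod => i; apply: loc_unit_exprz.
  by rewrite -emb_varE; apply: loc_unit_var.
by rewrite active_zlin; apply: loc_unit_zlin.
Qed.

Lemma loc_const c : loc (tofrac c%:MP).
Proof. by have := in_loc_phi phiR vars c%:MP; rewrite /= mmapC. Qed.

(** [z] is [T_0 / T_1], and each [y_j] is a Laurent monomial in the variables and in the
    [g_l(z) = T_l / T_1]. *)
Lemma loc_target p : loc (tofrac p).
Proof.
rewrite [p]mpolyE rmorph_sum; elim/big_ind: _ => [||m _].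
- by rewrite -(rmorph0 phiR); apply: in_loc_phi.
- exact: locD.
rewrite -mul_mpolyC rmorphM; apply: in_locM; first exact: loc_const.
rewrite mpolyXE_id rmorph_prod.
apply: (big_ind loc); [exact: loc_unit1.1|exact: in_locM|move=> v _].
rewrite rmorphXn exprnP /=; suff /(loc_unit_exprz (m v))[] : loc_unit (tofrac 'X_v) by [].
have [j ->|->] := unliftP ord0 v; first exact: loc_unit_yvar.
rewrite -[tofrac _]/(zvar k q) -zevalX.
by have := loc_unit_zlin ord0; rewrite /zlin lin0.
Qed.

(** The condition [denP] for an arbitrary element of [L], so that it can be checked through sums and
    products. *)
Definition has_den (x : L) := exists s : {mpoly k[q.+1]},
  [/\ s != 0, loc (tofrac s)^-1 & exists p, x * tofrac s = tofrac p].

Lemma has_den_num p : has_den (tofrac p).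
Proof.
exists 1; split; rewrite ?oner_neq0 ?rmorph1 ?invr1 //; first exact: loc_unit1.1.
by exists p; rewrite mulr1.
Qed.

Lemma has_denV p : p != 0 -> loc (tofrac p)^-1 -> has_den (tofrac p)^-1.
Proof.
by move=> p0 lp; exists p; split=> //; exists 1; rewrite mulVf ?tofrac_eq0 // rmorph1.
Qed.

Lemma has_denM x y : has_den x -> has_den y -> has_den (x * y).
Proof.
move=> [s [s0 ls [p e]]] [s' [s'0 ls' [p' e']]]; exists (s * s').
split; rewrite ?mulf_neq0 // rmorphM; first by rewrite invfM; apply: in_locM.
by exists (p * p'); rewrite mulrACA e e' rmorphM.
Qed.

Lemma has_denD x y : has_den x -> has_den y -> has_den (x + y).
Proof.
move=> [s [s0 ls [p e]]] [s' [s'0 ls' [p' e']]]; exists (s * s').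
split; rewrite ?mulf_neq0 // rmorphM; first by rewrite invfM; apply: in_locM.
exists (p * s' + p' * s).
by rewrite rmorphD !rmorphM /= -e -e'; ring.
Qed.

Lemma has_den_exprz p (e : int) : p != 0 -> loc (tofrac p)^-1 -> has_den (tofrac p ^ e).
Proof.
move=> p0 lp; have hX x m : has_den x -> has_den (x ^+ m).
  move=> hx; elim: m => [|m IH]; last by rewrite exprS; apply: has_denM.
  by rewrite expr0 -(rmorph1 tofrac); apply: has_den_num.
case: e => m; first exact/hX/has_den_num.
by rewrite NegzE -exprz_inv; apply/hX/has_denV.
Qed.

Lemma has_den_prod (J : finType) (F : J -> L) :
  (forall i, has_den (F i)) -> has_den (\prod_i F i).
Proof.
move=> hF; elim/big_ind: _ => //; last exact: has_denM.
by rewrite -(rmorph1 tofrac); apply: has_den_num.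
Qed.

(** The image of a variable has only powers of the [g_l(z)] and of the [y_j] in its denominator, and
    all of these are units of the localization. *)
Lemma has_den_emb c : has_den (phi c).
Proof.
rewrite [c]mpolyE rmorph_sum; elim/big_ind: _ => [||m _].
- by rewrite -(rmorph0 tofrac); apply: has_den_num.
- exact: has_denD.
rewrite /= mmapZ mmapX; apply: has_denM; first exact: has_den_num.
apply: has_den_prod => v; elim: (m v) => [|e IH].
  by rewrite expr0 -(rmorph1 tofrac); apply: has_den_num.
rewrite exprS; apply: has_denM => //; rewrite emb_varE /toric.
apply: has_denM; apply: has_den_prod => i.
  rewrite active_zlin; apply: has_den_exprz; last exact: (loc_unit_zlin _).2.
  by rewrite -tofrac_eq0 -[tofrac _]/(zeval q _) zeval_eq0 zlin_neq0.
apply: has_den_exprz; last exact: (loc_unit_yvar _).2.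
by rewrite -tofrac_eq0 -[tofrac _]/(yvar k i) yvar_neq0.
Qed.

Lemma polyC_relation (F : fieldType) (a b c l : F) (x : {poly F}) :
  a + l * b + c = 0 -> a%:P * x + l%:P * (b%:P * x) + c%:P * x = 0.
Proof. by move=> e; rewrite mulrA -polyCM -!mulrDl -!polyCD e mul0r. Qed.

Lemma polyC_monomial_eval1 (F : fieldType) (c a : F) e :
  (c%:P * (a%:P * 'X^e)).[1] = c * a.
Proof. by rewrite !hornerM !hornerC hornerXn expr1n mulr1. Qed.

Lemma leq_size_mulXn (F : fieldType) (p : {poly F}) e :
  p * 'X^e != 0 -> (e <= size (p * 'X^e)%R)%N.
Proof.
move=> pX0; have p0 : p != 0 by apply: contraNneq pX0 => ->; rewrite mul0r.
by rewrite size_mulXn // leq_addr.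
Qed.

(* A grading with positive weights making all T_l homogeneous of one degree. *)
Definition block_size l := #|[pred v | bl v == l]|.
Definition wt v : nat :=
  ((\prod_(u | u != v) be u) * \prod_(l | l != bl v) block_size l)%N.

Lemma block_size_gt0 l : (0 < block_size l)%N.
Proof. by apply/card_gt0P; exists (pt l); rewrite inE bl_pt. Qed.

Lemma wt_gt0 v : (0 < wt v)%N.
Proof.
by rewrite muln_gt0 !prodn_cond_gt0 // => l _; apply: block_size_gt0.
Qed.

(** Each of the [block_size l] variables of the block contributes the product of all exponents times
    the sizes of the other blocks. *)
Lemma wt_block l : (\sum_v wt v * bm l v = (\prod_u be u) * \prod_l block_size l)%N.
Proof.
rewrite (bigID (fun v => bl v == l)) /= [X in (_ + X)%N]big1 ?addn0; last first.
  by move=> v /negPf vl; rewrite mnmE vl muln0.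
rewrite (eq_bigr (fun=> (\prod_u be u * \prod_(l' | l' != l) block_size l')%N)).
  by rewrite sum_nat_const [in RHS](bigD1 l) //= mulnCA.
move=> v /eqP vl; rewrite mnmE vl eqxx /wt vl [in RHS](bigD1 v) //=.
by rewrite mulnAC [(_ * be v)%N]mulnC.
Qed.

(** [phi] with the weight recorded by an extra variable: evaluation at 1 gives [phi] back, and
    homogeneity of the relations makes it vanish on [I]. *)
Definition graded_emb : {rmorphism R -> {poly L}} :=
  mmap (polyC \o constL) (fun v => (h v)%:P * 'X^(wt v)).

Lemma graded_embX m : graded_emb 'X_[m] = (phi 'X_[m])%:P * 'X^(\sum_v wt v * m v).
Proof.
rewrite /graded_emb /= !mmapX /mmap1 rmorph_prod -prodrXr -big_split.
by apply: eq_bigr => v _ /=; rewrite exprMn rmorphXn -exprM.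
Qed.

Lemma graded_embZ c a : graded_emb (c *: a) = (tofrac c%:MP)%:P * graded_emb a.
Proof. by rewrite /graded_emb /= mmapZ. Qed.

Lemma graded_emb_ideal a : I a -> graded_emb a = 0.
Proof.
apply: gen_ideal_ker => l l2; rewrite !rmorphD graded_embZ !graded_embX !wt_block.
have e : phi (T ord0) + tofrac (lambda l)%:MP * phi (T i1) + phi (T l) = 0.
  have : phi (T ord0 + lambda l *: T i1 + T l) = 0.
    by apply/trinomial_ker; apply: (gen_ideal_gen (S := fun i : 'I_r.+1 => (2 <= i)%N)
      (fun i => T ord0 + lambda i *: T i1 + T i)).
  by rewrite !rmorphD /= mmapZ.
exact: polyC_relation e.
Qed.

Lemma graded_emb_eval a : (graded_emb a).[1] = phi a.
Proof.
rewrite [a]mpolyE !rmorph_sum horner_sum; apply: eq_bigr => m _.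
by rewrite graded_embZ graded_embX polyC_monomial_eval1 /= mmapZ.
Qed.

(** Each variable dividing [a] contributes at least one factor ['X] to [graded_emb a], because
    weights are positive; the size of that nonzero polynomial bounds their number. *)
Lemma vars_separated a : ~ I a -> exists e, forall (s : seq R) c, {subset s <= vars} ->
  phi a = phi (\prod_(t <- s) t) * phi c -> (size s <= e)%N.
Proof.
move=> a0; exists (size (graded_emb a)) => s c sT e.
have ga0 : graded_emb a != 0.
  apply/eqP=> ga; apply: a0; apply/trinomial_ker.
  by rewrite -graded_emb_eval ga horner0.
have ga : graded_emb a = graded_emb (\prod_(t <- s) t) * graded_emb c.
  apply/eqP; rewrite -rmorphM -subr_eq0 -rmorphB; apply/eqP/graded_emb_ideal/trinomial_ker.
  by rewrite rmorphB rmorphM /= e subrr.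
have [u gs] : exists u, graded_emb (\prod_(t <- s) t) = u * 'X^(size s).
  elim: (s) sT => [|t s' IH] sT; first by exists 1; rewrite big_nil rmorph1 mulr1.
  have [|u us] := IH; first by move=> t' t's; apply: sT; rewrite inE t's orbT.
  have /mapP[v _ ->] := sT t (mem_head _ _).
  exists ((h v)%:P * 'X^((wt v).-1) * u); rewrite big_cons rmorphM us /=.
  rewrite mmapX mmap1U -{1}(prednK (wt_gt0 v)) !exprS.
  by set x := 'X; set y := x ^+ _; set z := x ^+ _; ring.
by move: ga0; rewrite ga gs mulrAC; apply: leq_size_mulXn.
Qed.

Lemma trinomial_UFD : UFDQ I.
Proof.
apply: (UFDQ_ker (phi := phiR) trinomial_ker).
apply: (nagata (phi := phiR) trinomial_ker (j := tofrac) (T := vars)).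
- by move=> p /eqP; rewrite tofrac_eq0 => /eqP.
- exact: mpoly_factorial.
- exact: vars_prime.
- exact: loc_target.
- exact: has_den_emb.
- exact: vars_separated.
Qed.

Lemma expand_quotient (A : comNzRingType) (F : fieldType) (f : {rmorphism A -> F})
  (a b : F) (c c' t t' : A) : a * f t = f c -> b * f t' = f c' ->
  f t != 0 -> f t' != 0 -> a / b = f (c * t') / f (c' * t).
Proof.
move=> e e' t0 t'0; rewrite !rmorphM -e -e' -(mulrA a) -(mulrA b).
by rewrite (mulrC (f t)) -mulf_div [X in _ = _ * X]divff ?mulr1 // mulf_neq0.
Qed.

Lemma trinomial_rational : rationalQ I.
Proof.
exists q.+1, phiR; split; first by move=> c /=; rewrite mmapC.
split; first by move=> x; split=> /trinomial_ker.
move=> z; have [p [d' [d0 ->]]] := fraction_repr z.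
have [s [c [sT e]]] := loc_target p; have [s' [c' [s'T e']]] := loc_target d'.
have t0 := phi_prodT_neq0 trinomial_ker vars_prime sT.
have t'0 := phi_prodT_neq0 trinomial_ker vars_prime s'T.
exists (c * \prod_(t <- s') t), (c' * \prod_(t <- s) t).
exact: (expand_quotient e e' t0 t'0).
Qed.

Lemma trinomial_krull : krull_dimQ I (n - r + 1).
Proof.
have -> : (n - r + 1 = q.+1)%N by rewrite nE addKn addn1.
split; last first.
  apply: (krull_upper_bound (phi := phiR)) => [c|x]; first by rewrite /= mmapC.
  exact: trinomial_ker.
(* One variable from each block: killing them kills every [T_l], hence [I]. With [#|V0| = r + 1] the
   chain has length [(n - r - 1) + 2 = q + 1]. *)
pose V0 := [set pt l | l : 'I_r.+1].
have pt_inj : injective pt by move=> l l' e; rewrite -(bl_pt l) e bl_pt.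
have cV0 : #|V0| = r.+1 by rewrite card_imset // card_ord.
have -> : q.+1 = (n - #|V0|).+2.
  have := max_card (mem V0); rewrite card_ord cV0 nE; lia.
have pV l : pt l \in V0 by apply: imset_f.
have [f [df fX]] := var_special (pt ord0).
have killT l : kill_vars V0 (T l) = 0.
  rewrite /kill_vars mmapX /mmap1 (bigD1 (pt l)) //= pV mnmE bl_pt eqxx.
  by rewrite expr0n gtn_eqF // mul0r.
apply: (@krull_variable_chain k n I (dvdQ I 'X_(pt ord0)) V0).
- apply: (prime_ideal_iff (P := fun x => phiR x = 0)); last exact: prime_ideal_ker.
  by move=> x; split=> /trinomial_ker.
- apply: (prime_ideal_iff (P := fun x => f x = 0)); last exact: prime_ideal_ker.
  by move=> x; split=> /df.
- by move=> x Ix; exists 0; rewrite mulr0 subr0.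
- exists 'X_(pt ord0); split; last exact: var_not_in.
  by exists 1; rewrite mulr1 subrr; apply: gen_ideal0.
- move=> x [c Ixc]; rewrite -[x](subrK ('X_(pt ord0) * c)) rmorphD rmorphM /=.
  rewrite kill_varsX pV mul0r addr0; move: Ixc; apply: gen_ideal_ker => l l2.
  by rewrite !rmorphD -mul_mpolyC rmorphM /= !killT mulr0 !addr0.
(* This inclusion is strict because dividing by a variable of block 0 kills no variable of another
   block. *)
exists 'X_(pt i1); split; first by apply/eqP; rewrite kill_varsX_eq0.
by move=> /df/eqP; rewrite (negPf (fX _ _)) // !bl_pt i1_neq0.
Qed.

End Embedding.

Theorem trinomial_properties : UFDQ I /\ rationalQ I /\ krull_dimQ I (n - r + 1) /\
  (forall mu : k, mu != 0 -> (forall i : 'I_r.+1, (2 <= i)%N -> mu != lambda i) ->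
     primeQ I (T ord0 + mu *: T i1)).
Proof.
have [N MN] := bmat_right_inverse i1 cop_d bezout_d.
have [E [E' [ME EE kerE]]] := bmat_complement nE MN.
split; first exact: (trinomial_UFD MN ME EE kerE).
split; first exact: (trinomial_rational MN ME EE kerE).
split; first exact: (trinomial_krull MN ME kerE).
exact: (line_prime MN ME kerE).
Qed.

End Trinomial.

(** * Translation from variables indexed by pairs to a single index set *)

Lemma big_tagnat_block (A : Type) (idx : A) (op : Monoid.com_law idx) (r : nat)
  (ns : 'I_r -> nat) (i : 'I_r) (F : 'I_(\sum_l ns l) -> A) :
  \big[op/idx]_(v | tagnat.sig1 v == i) F v =
  \big[op/idx]_(j < ns i) F (tagnat.Rank i j).
Proof.
pose G v := if tagnat.sig1 v == i then F v else idx.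
transitivity (\big[op/idx]_(i' < r) \big[op/idx]_(j < ns i') G (tagnat.Rank i' j)).
  rewrite sig_big_dep big_mkcond (reindex (@tagnat.rank _ ns)) /=; last first.
    exact: onW_bij (@tagnat.rank_bij _ ns).
  by apply: eq_bigr => p _; rewrite tagnat.rankE.
rewrite /G (bigD1 i) //= [X in op _ X]big1 ?Monoid.mulm1; last first.
  by move=> i' /negPf ii'; rewrite big1 // => j _; rewrite tagnat.Rank1K ii'.
by apply: eq_bigr => j _; rewrite tagnat.Rank1K eqxx.
Qed.

Lemma gcdn_bezout (m : nat) (b : 'I_m -> nat) : exists u : 'I_m -> int,
  \sum_j u j * (b j)%:Z = (\big[gcdn/0%N]_j b j)%:Z.
Proof.
elim: m b => [|m IH] b; first by exists (fun=> 0); rewrite !big_ord0.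
have [u eu] := IH (fun j => b (lift ord0 j)).
have [x [y exy]] := Bezoutz (b ord0) (\big[gcdn/0%N]_j b (lift ord0 j)).
exists (fun j => if unlift ord0 j is Some j' then y * u j' else x).
rewrite big_ord_recl unlift_none [in RHS]big_ord_recl -[RHS]exy -eu mulr_sumr.
by congr (_ + _); apply: eq_bigr => j _; rewrite liftK mulrA.
Qed.

Theorem theorem5p1
  (k : fieldType) (r : nat) (ns : 'I_r.+1 -> nat)
  (beta : forall i : 'I_r.+1, 'I_(ns i) -> nat)
  (lambda : 'I_r.+1 -> k)
  (hr : (2 <= r)%N)
  (hn : (2 <= \sum_(i < r.+1) ns i)%N)
  (hns : forall i, (1 <= ns i)%N)
  (hbeta : forall i j, (0 < beta i j)%N)
  (hcop : forall i i' : 'I_r.+1, i != i' ->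
            coprime (dgcd beta i) (dgcd beta i'))
  (hlam0 : forall i : 'I_r.+1, (2 <= i)%N -> lambda i != 0)
  (hlam : forall i i' : 'I_r.+1, (2 <= i)%N -> (2 <= i')%N -> i != i' ->
            lambda i != lambda i') :
  let n := (\sum_(i < r.+1) ns i)%N in
  let T : 'I_r.+1 -> {mpoly k[n]} := Tpow k beta in
  let I := gen_ideal (fun i : 'I_r.+1 => (2 <= i)%N)
             (fun i => T ord0 + lambda i *: T (inord 1) + T i) in
  UFDQ I /\ rationalQ I /\ krull_dimQ I (n - r + 1) /\
  (forall mu : k, mu != 0 -> (forall i : 'I_r.+1, (2 <= i)%N -> mu != lambda i) ->
     primeQ I (T ord0 + mu *: T (inord 1))).
Proof.
move=> n; pose bl (v : 'I_n) := tagnat.sig1 v.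
pose be (v : 'I_n) := beta (tagnat.sig1 v) (tagnat.sig2 v).
have [bz bezout] := fin_all_exists (fun i => gcdn_bezout (beta i)).
have beR i j : be (tagnat.Rank i j) = beta i j.
  by rewrite /be /tagnat.sig1 /tagnat.sig2 /tagnat.Rank tagnat.rankK.
(* A product over one block becomes a product over all variables, with exponent 0 outside the
   block. *)
have -> : Tpow k beta = fun l => 'X_[bmon bl be l].
  apply: functional_extensionality => l; rewrite mpolyXE_id /Tpow.
  transitivity (\prod_(v | tagnat.sig1 v == l) ('X_v : {mpoly k[n]}) ^+ be v).
    by rewrite big_tagnat_block; apply: eq_bigr => j _; rewrite beR.
  rewrite [LHS]big_mkcond; apply: eq_bigr => v _; rewrite mnmE /bl.
  by case: ifP => // _; rewrite expr0.
(* Each of the [r + 1] blocks is nonempty, so [q = n - r] is a true difference. *)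
have le_rn : (r <= n)%N.
  rewrite ltnW // -[r.+1](card_ord r.+1) -sum1_card; exact: leq_sum.
apply: (@trinomial_properties k r n (n - r) bl be lambda
  (fun l => tagnat.Rank l (Ordinal (hns l)))
  (fun v => bz (tagnat.sig1 v) (tagnat.sig2 v)) (dgcd beta)) => //.
- by rewrite subnKC.
- by move=> l; rewrite /bl tagnat.Rank1K.
- by move=> v; apply: hbeta.
move=> l; rewrite -[RHS]bezout.
transitivity (\sum_(v | tagnat.sig1 v == l) bz _ (tagnat.sig2 v) * (be v)%:Z); first by [].
rewrite big_tagnat_block; apply: eq_bigr => j _.
by rewrite beR /tagnat.sig1 /tagnat.sig2 /tagnat.Rank tagnat.rankK.
Qed.
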